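(* For every $k\in\mathbb{Z}$ we have $$ \lim_{d\to\infty} \frac{A[d,k]}{d^{3k/2}} = \frac{1}{6^{k/2}\, \Gamma\left(\frac k2 + 1\right)}. $$
   Context: For $n\in\mathbb{N}_0=\{0,1,2,\ldots\}$ and $k\in\mathbb{Z}$ with $k\le n$, the number $A[n,k]$ is defined by $$ A[n,k] := \frac{n!}{(n-k)!}\, \frac 1 {\pi} \int_{-\infty}^{+\infty} (\cosh x)^{-n-1} \left(\frac \pi 2 + \mathrm{i} x\right)^{n-k} \mathrm{d} x , $$ where $\mathrm{i}$ is the imaginary unit. The limit is taken along integers $d\to\infty$ (with $d\ge \max(k,1)$). $\Gamma$ is Euler's Gamma function, with the convention $1/\Gamma(x)=0$ when $x\in\{0,-1,-2,\ldots\}$; thus for $k\in\{-2,-4,\ldots\}$ the right-hand side is $0$. *)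

(* Defs.v *)
From HB Require Import structures.
From mathcomp Require Import all_boot all_order all_algebra.
From mathcomp Require Import all_classical all_reals all_analysis.
From mathcomp Require Import complex.
Set Implicit Arguments.
Unset Strict Implicit.
Unset Printing Implicit Defensive.
Import Order.TTheory GRing.Theory Num.Theory.
Import numFieldNormedType.Exports.
Local Open Scope classical_set_scope.
Local Open Scope ring_scope.
Local Open Scope complex_scope.

Definition cosh (R : realType) (x : R) : R := (expR x + expR (- x)) / 2.

(* Lebesgue integral over the real line of a complex-valued function,
   taken on the real and imaginary parts. *)
Definition cintegral (R : realType) (f : R -> R[i]) : R[i] :=
  (\int[@lebesgue_measure R]_x complex.Re (f x))%R +i*
  (\int[@lebesgue_measure R]_x complex.Im (f x))%R.

(* Meaningful for k <= n only: for k > n, the absolute value in the factorial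
   and the negative power of the base are arbitrary. *)
Definition A (R : realType) (n : nat) (k : int) : R[i] :=
  ((n`!%:R / (`|n%:Z - k|%N)`!%:R) * (pi : R)^-1)%:C *
  cintegral (fun x : R =>
    (cosh x ^- n.+1)%:C * ((pi / 2) +i* x) ^ (n%:Z - k)).

(* Euler's integral, convergent for 0 < x. *)
Definition Gamma_integral (R : realType) (x : R) : R :=
  (\int[@lebesgue_measure R]_(t in `]0, +oo[) (t `^ (x - 1) * expR (- t)))%R.

(* Euler's Gamma function on the reals: for x <= 0, the continuation given by
   Gamma x = Gamma (x + m) / (x (x + 1) ... (x + m - 1)), where m is the least
   natural number with 0 < x + m. *)
Definition Gamma (R : realType) (x : R) : R :=
  if 0 < x then Gamma_integral x
  else let m := (Num.truncn (- x)).+1 in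
       Gamma_integral (x + m%:R) / \prod_(j < m) (x + j%:R).

(* 1 / Gamma, equal to 0 at the poles 0, -1, -2, ... of Gamma. *)
Definition inv_Gamma (R : realType) (x : R) : R :=
  if `[< exists j : nat, x = - j%:R >] then 0 else (Gamma x)^-1.

(* Main.v *)
(** With [z = pi/2 + ix] one has [cosh x = sin z], so [A[n,k]] is, up to the factor
    [n! / ((n-k)! pi)], the integral of [z^(n-k) / (sin z)^(n+1)] over the line
    [Re z = pi/2].

    For [k = -p < 0] the integrand is regular at [0] and the line can be shifted to
    the imaginary axis, where the integrand becomes [(ix)^(p-1) (x / sinh x)^(n+1)].
    For even [p] its real part vanishes; for odd [p] the rescaling
    [x = sqrt (6 / (n+1)) v] and dominated convergence,
    [(x / sinh x)^(n+1) -> exp (- v^2)], lead to the integral for [Gamma (p/2)].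
    The shift itself needs no Cauchy theorem: the [s]-derivative of the integral over
    [Re z = s] is the integral of an [x]-derivative, hence zero.

    Integrating by parts twice yields
    [A[n+2,k] = A[n,k] + (n+1)^2 A[n,k-2]]. Since [A[n,-2] = 0], this gives
    [A[n,0] = 1]; for [k > 0] summing it (Stolz-Cesaro) multiplies the limit by
    [1 / (3k)] when passing from [k-2] to [k], in accordance with
    [Gamma (x+1) = x Gamma x]. *)

Require Import Defs.
From mathcomp Require Import all_boot all_order all_algebra.
From mathcomp Require Import all_classical all_reals all_analysis.
From mathcomp Require Import measurable_realfun.
From mathcomp Require Import complex ring lra zify.
Set Implicit Arguments.
Unset Strict Implicit.
Unset Printing Implicit Defensive.
Import Order.TTheory GRing.Theory Num.Theory.
Import numFieldNormedType.Exports.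
Local Open Scope classical_set_scope.
Local Open Scope ring_scope.
Local Open Scope complex_scope.


(** For [k > 0] the integrand [z^(n-k) / (sin z)^(n+1)] has a pole of order [k + 1] at [0], which
    keeps the line from reaching the imaginary axis; hence the detour through negative [k] and the
    recurrence. As the latter moves [k] by 2, two chains are needed: even [k] starts from [0], odd
    [k] from [-1]. For [k = -p] the exponent [3k/2] has two sources: the factorials contribute
    [n^(-p)], the rescaling [n^(-p/2)]. The [6] is that of [sinh x = x + x^3/6 + ...]. What comes
    out is [Gamma (p/2) / pi] up to sign, whereas the claim has [1 / Gamma (1 - p/2)]; they agree by
    the reflection formula at half-integers, a consequence of [Gamma (x+1) = x Gamma x] and the
    Gaussian value [Gamma (1/2)^2 = pi]. The [s]-derivative and the limits [s -> 0] and [n -> oo]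
    are all taken under the integral with a majorant [K / (1 + x^2)]. The delicate points are
    uniformity as [s -> 0], where [sin z] becomes small near the origin, and uniformity in [n] after
    rescaling, where the available bound is [(1 + v^2/n)^(-n)]. *)

Local Notation mu := (@lebesgue_measure _).
Local Notation normc := (@Normc.normc _).

(** * Hyperbolic functions *)

Definition sinh (R : realType) (x : R) : R := (expR x - expR (- x)) / 2.

Lemma is_derive_expRN (R : realType) (x : R) :
  is_derive x 1 (fun t : R => expR (- t)) (- expR (- x)).
Proof.
apply: is_derive_eq (is_derive1_comp (is_derive_expR _) (is_deriveNid _ _)) _.
by rewrite mulrN1.
Qed.

Lemma is_derive_cosh (R : realType) (x : R) : is_derive x 1 (@cosh R) (sinh x).
Proof.
rewrite /cosh /sinh.
apply: is_derive_eq (is_deriveM (is_deriveD (is_derive_expR x) (is_derive_expRN x))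
  (is_derive_cst (2^-1 : R) _ _)) _.
by rewrite /= /GRing.scale/=; ring.
Qed.

Lemma is_derive_sinh (R : realType) (x : R) : is_derive x 1 (@sinh R) (cosh x).
Proof.
rewrite /cosh /sinh.
apply: is_derive_eq (is_deriveM (is_deriveB (is_derive_expR x) (is_derive_expRN x))
  (is_derive_cst (2^-1 : R) _ _)) _.
by rewrite /= /GRing.scale/=; ring.
Qed.

Lemma is_derive1_continuous (R : realType) (f : R -> R) (x df : R) :
  is_derive x 1 f df -> {for x, continuous f}.
Proof.
by move=> [df1 _]; apply/differentiable_continuous/derivable1_diffP.
Qed.

Lemma continuous_expRN (R : realType) : continuous (fun t : R => expR (- t)).
Proof. by move=> x; apply: is_derive1_continuous (is_derive_expRN x). Qed.

Lemma continuous_cosh (R : realType) : continuous (@cosh R).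
Proof. by move=> x; apply: is_derive1_continuous (is_derive_cosh x). Qed.

Lemma continuous_sinh (R : realType) : continuous (@sinh R).
Proof. by move=> x; apply: is_derive1_continuous (is_derive_sinh x). Qed.

Lemma coshN (R : realType) (x : R) : cosh (- x) = cosh x.
Proof. by rewrite /cosh opprK addrC. Qed.

Lemma sinhN (R : realType) (x : R) : sinh (- x) = - sinh x.
Proof. by rewrite /sinh opprK -mulNr opprB. Qed.

Lemma cosh0 (R : realType) : cosh 0 = 1 :> R.
Proof. by rewrite /cosh oppr0 expR0; lra. Qed.

Lemma sinh0 (R : realType) : sinh 0 = 0 :> R.
Proof. by rewrite /sinh oppr0 expR0; lra. Qed.

Lemma cosh2Bsinh2 (R : realType) (x : R) : cosh x ^+ 2 - sinh x ^+ 2 = 1.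
Proof.
by transitivity (expR x * expR (- x)); [rewrite /cosh /sinh; field|exact: expRxMexpNx_1].
Qed.

Lemma cosh_gt0 (R : realType) (x : R) : 0 < cosh x.
Proof. by rewrite divr_gt0// addr_gt0// expR_gt0. Qed.

Lemma cosh_ge1 (R : realType) (x : R) : 1 <= cosh x.
Proof.
rewrite -(@ler_pXn2r _ 2%N) ?nnegrE ?ler01 ?(ltW (cosh_gt0 _))//.
by have := cosh2Bsinh2 x; have := sqr_ge0 (sinh x); lra.
Qed.

Lemma cosh_ge_expR_norm (R : realType) (x : R) : expR `|x| / 2 <= cosh x.
Proof.
rewrite /cosh ler_pM2r ?invr_gt0//.
have [x0|x0] := ger0P x; first by rewrite ler_wpDr ?expR_ge0.
by rewrite ler_wpDl ?expR_ge0.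
Qed.

(** Mean value theorem for [g - f] on [[0, x]]. Applied along a chain of derivatives it yields the
    Taylor-type bounds on [sinh], [cosh], [sin] and [cos]. *)
Lemma is_derive_le (R : realType) (b : R) (f g f' g' : R -> R) :
  (forall x : R, is_derive x 1 f (f' x)) ->
  (forall x : R, is_derive x 1 g (g' x)) ->
  f 0 <= g 0 -> (forall x : R, 0 <= x <= b -> f' x <= g' x) ->
  forall x : R, 0 <= x <= b -> f x <= g x.
Proof.
move=> hf hg fg0 fg' x /andP[x0 xb].
have hd (y : R) : is_derive y 1 (g \- f) (g' y - f' y) by apply: is_deriveB.
have [|c] := @MVT_segment _ (g \- f) (fun y => g' y - f' y) 0 x x0 (fun y _ => hd y).
  by apply: derivable_within_continuous => y _; exact: (@ex_derive _ _ _ _ _ _ _ (hd y)).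
rewrite in_itv/= => /andP[c0 cx] /=.
have : 0 <= g' c - f' c by rewrite subr_ge0 fg'// c0 (le_trans cx).
move: x0; rewrite -subr_ge0 => x0 h e.
by have := mulr_ge0 h x0; rewrite -e; lra.
Qed.

Lemma is_derive_polyn (R : realType) (n : nat) (c x : R) :
  is_derive x 1 (fun t : R => c * t ^+ n) (c * n%:R * x ^+ n.-1).
Proof.
have -> : (fun t : R => c * t ^+ n) = cst c * (@id R) ^+ n.
  by apply/funext => t; rewrite !fctE.
apply: is_derive_eq (is_deriveM (is_derive_cst c x 1)
   (is_deriveX n (is_derive_id x 1))) _.
by rewrite /= /GRing.scale/=; ring.
Qed.

Lemma sinh_ge (R : realType) (x : R) : 0 <= x -> x + x ^+ 3 / 6 <= sinh x.
Proof.
move=> x0; pose I (y : R) := 0 <= y <= x.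
have Dx (y : R) : is_derive y 1 (id : R -> R) 1 by exact: is_derive_id.
have s1 y : I y -> y <= sinh y.
  apply: (@is_derive_le R x id (@sinh R) (cst 1) (@cosh R)) => //.
  - exact: is_derive_sinh.
  - by rewrite sinh0.
  - by move=> z _; exact: cosh_ge1.
have c2 y : I y -> 1 + 2^-1 * y ^+ 2 <= cosh y.
  apply: (@is_derive_le R x (fun y => 1 + 2^-1 * y ^+ 2) (@cosh R) id (@sinh R)) => //.
  - move=> z; apply: is_derive_eq (is_deriveD (is_derive_cst (1 : R) z 1)
      (is_derive_polyn 2 _ z)) _.
    by rewrite /= expr1; field.
  - exact: is_derive_cosh.
  - by rewrite cosh0 expr0n mulr0 addr0.
suff : forall y, I y -> y + 6^-1 * y ^+ 3 <= sinh y.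
  by move/(_ x); rewrite /I x0 lexx mulrC; apply.
apply: (@is_derive_le R x (fun y => y + 6^-1 * y ^+ 3) (@sinh R) (fun y => 1 + 2^-1 * y ^+ 2) (@cosh R)) => //.
- move=> z; apply: is_derive_eq (is_deriveD (Dx z) (is_derive_polyn 3 _ z)) _.
  by rewrite /=; field.
- exact: is_derive_sinh.
- by rewrite sinh0 expr0n mulr0 addr0.
Qed.

(** Only the order [x^5] of the remainder matters later. The crude start [cosh <= 360 = 3 * 5!] is
    integrated five times, through [360 y], [180 y^2], [60 y^3], [15 y^4] to [3 y^5], so that the
    remainder coefficients stay integers. *)
Lemma sinh_le (R : realType) (x : R) : 0 <= x <= 1 ->
  sinh x <= x + x ^+ 3 / 6 + 3 * x ^+ 5.
Proof.
have Dx (y : R) : is_derive y 1 (id : R -> R) 1 by exact: is_derive_id.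
have c0 (y : R) : 0 <= y <= 1 -> cosh y <= 360.
  move=> /andP[y0 y1]; rewrite /cosh.
  (* Inverse of [exp (-1/2) >= 1 - 1/2]; squaring then gives [exp 1 <= 4]. *)
  have e3 : expR (2^-1 : R) <= 2.
    rewrite -[leRHS]invrK -[X in expR X]opprK expRN lef_pV2 ?posrE ?expR_gt0 ?invr_gt0//.
    by rewrite (le_trans _ (expR_ge1Dx _))//; lra.
  have ey : expR y <= 4.
    rewrite (@le_trans _ _ (expR (2^-1 + 2^-1)))//; first by rewrite ler_expR; lra.
    rewrite expRD (_ : 4 = 2 * 2); last by lra.
    by rewrite ler_pM ?expR_ge0.
  have : expR (- y) <= 1 by rewrite expR_le1 oppr_le0.
  by lra.
have s1 (y : R) : 0 <= y <= 1 -> sinh y <= 360 * y.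
  apply: (@is_derive_le R 1 (@sinh R) (fun y => 360 * y ^+ 1) (@cosh R) (cst 360)) => //.
  - exact: is_derive_sinh.
  - move=> z; apply: is_derive_eq (is_derive_polyn 1 360 z) _.
    by rewrite /= expr0; ring.
  - by rewrite sinh0 mulr0.
have c2 (y : R) : 0 <= y <= 1 -> cosh y <= 1 + 180 * y ^+ 2.
  apply: (@is_derive_le R 1 (@cosh R) (fun y => 1 + 180 * y ^+ 2) (@sinh R) (fun y => 360 * y)) => //.
  - exact: is_derive_cosh.
  - move=> z; apply: is_derive_eq (is_deriveD (is_derive_cst (1 : R) z 1)
      (is_derive_polyn 2 _ z)) _.
    by rewrite /= expr1; field.
  - by rewrite cosh0 expr0n mulr0 addr0.
have s3 (y : R) : 0 <= y <= 1 -> sinh y <= y + 60 * y ^+ 3.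
  apply: (@is_derive_le R 1 (@sinh R) (fun y => y + 60 * y ^+ 3) (@cosh R) (fun y => 1 + 180 * y ^+ 2)) => //.
  - exact: is_derive_sinh.
  - move=> z; apply: is_derive_eq (is_deriveD (Dx z) (is_derive_polyn 3 _ z)) _.
    by rewrite /=; field.
  - by rewrite sinh0 expr0n mulr0 addr0.
have c4 (y : R) : 0 <= y <= 1 -> cosh y <= 1 + 2^-1 * y ^+ 2 + 15 * y ^+ 4.
  apply: (@is_derive_le R 1 (@cosh R) (fun y => 1 + 2^-1 * y ^+ 2 + 15 * y ^+ 4) (@sinh R) (fun y => y + 60 * y ^+ 3)) => //.
  - exact: is_derive_cosh.
  - move=> z; apply: is_derive_eq (is_deriveD (is_deriveD
      (is_derive_cst (1 : R) z 1) (is_derive_polyn 2 _ z)) (is_derive_polyn 4 _ z)) _.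
    by rewrite /= expr1; field.
  - by rewrite cosh0 !expr0n !mulr0 !addr0.
suff : forall y : R, 0 <= y <= 1 -> sinh y <= y + 6^-1 * y ^+ 3 + 3 * y ^+ 5.
  by move=> h x01; have := h _ x01; rewrite [6^-1 * _]mulrC.
apply: (@is_derive_le R 1 (@sinh R) (fun y => y + 6^-1 * y ^+ 3 + 3 * y ^+ 5) (@cosh R)
  (fun y => 1 + 2^-1 * y ^+ 2 + 15 * y ^+ 4)) => //.
- exact: is_derive_sinh.
- move=> z; apply: is_derive_eq (is_deriveD (is_deriveD
    (Dx z) (is_derive_polyn 3 _ z)) (is_derive_polyn 5 _ z)) _.
  by rewrite /=; field.
- by rewrite sinh0 !expr0n !mulr0 !addr0.
Qed.

(** * Derivatives of complex-valued functions of a real variable *)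

(** The two parts are kept apart so that each can be fed to the real fundamental theorem of calculus
    and to differentiation under the integral sign. *)
Definition is_cderive (R : realType) (x : R) (f : R -> R[i]) (l : R[i]) :=
  is_derive x 1 (fun t => complex.Re (f t)) (complex.Re l) /\
  is_derive x 1 (fun t => complex.Im (f t)) (complex.Im l).

Lemma is_cderive_eq (R : realType) (x : R) (f : R -> R[i]) (l l' : R[i]) :
  is_cderive x f l -> l = l' -> is_cderive x f l'.
Proof. by move=> + <-. Qed.

Lemma is_cderive_cst (R : realType) (x : R) (c : R[i]) : is_cderive x (cst c) 0.
Proof. by split; exact: is_derive_cst. Qed.

Lemma is_cderiveD (R : realType) (x : R) (f g : R -> R[i]) (df dg : R[i]) :
  is_cderive x f df -> is_cderive x g dg ->
  is_cderive x (fun t => f t + g t) (df + dg).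
Proof.
move=> [f1 f2] [g1 g2]; split.
- have -> : (fun t => complex.Re (f t + g t)) =
    (fun t => complex.Re (f t)) + (fun t => complex.Re (g t)).
    by apply/funext => t; rewrite !fctE; case: (f t); case: (g t).
  by apply: is_derive_eq (is_deriveD f1 g1) _; case: (df); case: (dg).
- have -> : (fun t => complex.Im (f t + g t)) =
    (fun t => complex.Im (f t)) + (fun t => complex.Im (g t)).
    by apply/funext => t; rewrite !fctE; case: (f t); case: (g t).
  by apply: is_derive_eq (is_deriveD f2 g2) _; case: (df); case: (dg).
Qed.

Lemma is_cderiveM (R : realType) (x : R) (f g : R -> R[i]) (df dg : R[i]) :
  is_cderive x f df -> is_cderive x g dg ->
  is_cderive x (fun t => f t * g t) (f x * dg + g x * df).
Proof.
move=> [f1 f2] [g1 g2]; split.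
- have -> : (fun t => complex.Re (f t * g t)) =
    (fun t => complex.Re (f t)) * (fun t => complex.Re (g t)) -
    (fun t => complex.Im (f t)) * (fun t => complex.Im (g t)).
    by apply/funext => t; rewrite !fctE; case: (f t); case: (g t).
  apply: is_derive_eq (is_deriveB (is_deriveM f1 g1) (is_deriveM f2 g2)) _.
  by rewrite /GRing.scale/=; case: (df); case: (dg); case: (f x); case: (g x) => * /=; ring.
- have -> : (fun t => complex.Im (f t * g t)) =
    (fun t => complex.Re (f t)) * (fun t => complex.Im (g t)) +
    (fun t => complex.Im (f t)) * (fun t => complex.Re (g t)).
    by apply/funext => t; rewrite !fctE; case: (f t); case: (g t).
  apply: is_derive_eq (is_deriveD (is_deriveM f1 g2) (is_deriveM f2 g1)) _.
  by rewrite /GRing.scale/=; case: (df); case: (dg); case: (f x); case: (g x) => * /=; ring.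
Qed.

Lemma is_cderiveZ (R : realType) (x : R) (c : R[i]) (f : R -> R[i]) (df : R[i]) :
  is_cderive x f df -> is_cderive x (fun t => c * f t) (c * df).
Proof.
move=> h; apply: is_cderive_eq (is_cderiveM (is_cderive_cst x c) h) _.
by rewrite mulr0 addr0.
Qed.

Lemma is_cderiveX (R : realType) (x : R) (n : nat) (f : R -> R[i]) (df : R[i]) :
  is_cderive x f df ->
  is_cderive x (fun t => f t ^+ n) (n%:R * f x ^+ n.-1 * df).
Proof.
move=> h; elim: n => [|n ih].
  by rewrite !mul0r; exact: (is_cderive_cst x 1).
rewrite (_ : (fun t => _) = (fun t => f t * f t ^+ n)); last first.
  by apply/funext => t; rewrite exprS.
apply: is_cderive_eq (is_cderiveM h ih) _.
by case: n {ih} => [|n] /=; rewrite ?expr0 -?natr1 ?exprS; ring.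
Qed.

Lemma is_cderiveV (R : realType) (x : R) (f : R -> R[i]) (df : R[i]) :
  f x != 0 -> is_cderive x f df ->
  is_cderive x (fun t => (f t)^-1) (- df / f x ^+ 2).
Proof.
move=> fx0 [f1 f2].
have hn : complex.Re (f x) ^+ 2 + complex.Im (f x) ^+ 2 != 0.
  apply: contra fx0; rewrite paddr_eq0 ?sqr_ge0// !sqrf_eq0 => /andP[/eqP h1 /eqP h2].
  by case: (f x) h1 h2 => a b /= -> ->.
have dN : is_derive x 1
    (fun t => complex.Re (f t) ^+ 2 + complex.Im (f t) ^+ 2)
    (2 * (complex.Re (f x) * complex.Re df + complex.Im (f x) * complex.Im df)).
  have -> : (fun t => complex.Re (f t) ^+ 2 + complex.Im (f t) ^+ 2) =
    (fun t => complex.Re (f t)) * (fun t => complex.Re (f t)) +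
    (fun t => complex.Im (f t)) * (fun t => complex.Im (f t)).
    by apply/funext => t; rewrite !fctE !expr2.
  apply: is_derive_eq (is_deriveD (is_deriveM f1 f1) (is_deriveM f2 f2)) _.
  by rewrite /GRing.scale/=; ring.
have dV := @is_deriveV R (fun t => complex.Re (f t) ^+ 2 + complex.Im (f t) ^+ 2) _ _ _ hn dN.
split.
- have -> : (fun t => complex.Re (f t)^-1) = (fun t => complex.Re (f t)) *
     (fun t => (complex.Re (f t) ^+ 2 + complex.Im (f t) ^+ 2)^-1).
    by apply/funext => t; rewrite !fctE; case: (f t).
  apply: is_derive_eq (is_deriveM f1 dV) _.
  move: hn; rewrite /GRing.scale/=; case: (df) => c d; case: (f x) => a b /= hn.
  have -> : (a * a - b * b) ^+ 2 + (a * b + b * a) ^+ 2 = (a ^+ 2 + b ^+ 2) ^+ 2.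
    by ring.
  by field.
- have -> : (fun t => complex.Im (f t)^-1) = - ((fun t => complex.Im (f t)) *
     (fun t => (complex.Re (f t) ^+ 2 + complex.Im (f t) ^+ 2)^-1)).
    by apply/funext => t; rewrite !fctE; case: (f t).
  apply: is_derive_eq (is_deriveN (is_deriveM f2 dV)) _.
  move: hn; rewrite /GRing.scale/=; case: (df) => c d; case: (f x) => a b /= hn.
  have -> : (a * a - b * b) ^+ 2 + (a * b + b * a) ^+ 2 = (a ^+ 2 + b ^+ 2) ^+ 2.
    by ring.
  by field.
Qed.

(* [csin s x] and [ccos s x] are the values of [sin] and [cos] at [s + ix]. *)
Definition csin (R : realType) (s x : R) : R[i] :=
  (sin s * cosh x) +i* (cos s * sinh x).

Definition ccos (R : realType) (s x : R) : R[i] :=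
  (cos s * cosh x) +i* - (sin s * sinh x).

Lemma is_derive_scale (R : realType) (x c : R) (f : R -> R) (df l : R) :
  is_derive x 1 f df -> c * df = l -> is_derive x 1 (fun t => c * f t) l.
Proof.
move=> h <-; apply: is_derive_eq (is_deriveM (is_derive_cst c x 1) h) _.
by rewrite /GRing.scale/=; ring.
Qed.

Lemma is_derive_scaler (R : realType) (x c : R) (f : R -> R) (df l : R) :
  is_derive x 1 f df -> df * c = l -> is_derive x 1 (fun t => f t * c) l.
Proof.
move=> h <-; apply: is_derive_eq (is_deriveM h (is_derive_cst c x 1)) _.
by rewrite /GRing.scale/=; ring.
Qed.

Lemma is_cderive_csin1 (R : realType) (s x : R) :
  is_cderive s (fun t => csin t x) (ccos s x).
Proof.
split; first by apply: (is_derive_scaler (@is_derive_sin R s)).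
by apply: (is_derive_scaler (@is_derive_cos R s)); rewrite /= mulNr.
Qed.

Lemma is_cderive_csin2 (R : realType) (s x : R) :
  is_cderive x (csin s) ('i%C * ccos s x).
Proof.
split => /=.
- by apply: (is_derive_scale (is_derive_cosh x)); ring.
- by apply: (is_derive_scale (is_derive_sinh x)); ring.
Qed.

Lemma is_cderive_ccos2 (R : realType) (s x : R) :
  is_cderive x (ccos s) (- 'i%C * csin s x).
Proof.
split => /=.
- by apply: (is_derive_scale (is_derive_cosh x)); ring.
- apply: is_derive_eq (is_deriveN (is_derive_scale (is_derive_sinh x) (erefl _))) _.
  by ring.
Qed.

Lemma is_cderive_line1 (R : realType) (s x : R) :
  is_cderive s (fun t => t +i* x) 1.
Proof. by split => /=; [exact: is_derive_id|exact: is_derive_cst]. Qed.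

Lemma is_cderive_line2 (R : realType) (s x : R) :
  is_cderive x (fun t => s +i* t) 'i%C.
Proof. by split => /=; [exact: is_derive_cst|exact: is_derive_id]. Qed.

Lemma ccos2Dcsin2 (R : realType) (s x : R) : ccos s x ^+ 2 + csin s x ^+ 2 = 1.
Proof.
rewrite /ccos /csin !expr2; apply/eqP; rewrite eq_complex /=; apply/andP; split.
  have e1 := cosh2Bsinh2 x; have e2 := cos2Dsin2 s.
  apply/eqP; transitivity ((cos s ^+ 2 + sin s ^+ 2) * (cosh x ^+ 2 - sinh x ^+ 2)).
    by ring.
  by rewrite e1 e2 mulr1.
by apply/eqP; ring.
Qed.

(* [z^j / (sin z)^m] at [z = s + ix]; [dczsin] is its derivative in [z]. *)
Definition czsin (R : realType) (j m : nat) (s x : R) : R[i] :=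
  (s +i* x) ^+ j / csin s x ^+ m.

Definition dczsin (R : realType) (j m : nat) (s x : R) : R[i] :=
  j%:R * czsin j.-1 m s x - m%:R * (ccos s x * czsin j m.+1 s x).

(** With [z] and [w] left arbitrary, one computation serves both the derivative in [s] and the
    derivative in [x]; the Cauchy-Riemann relation between them then appears as the factor [i]. *)
Lemma is_cderive_czsin (R : realType) (j m : nat) (t : R) (z w : R -> R[i])
    (dz dw : R[i]) : w t != 0 ->
  is_cderive t z dz -> is_cderive t w dw ->
  is_cderive t (fun t => z t ^+ j / w t ^+ m)
   (j%:R * (z t ^+ j.-1 / w t ^+ m) * dz - m%:R * (dw * (z t ^+ j / w t ^+ m.+1))).
Proof.
move=> w0 hz hw.
have h := is_cderiveM (is_cderiveX j hz) (is_cderiveX m (is_cderiveV w0 hw)).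
rewrite (_ : (fun _ => _) = (fun u => z u ^+ j * (w u)^-1 ^+ m)); last first.
  by apply/funext => u; rewrite exprVn.
apply: is_cderive_eq h _; case: m => [|m] /=.
  by rewrite !mul0r mulr0 add0r subr0 expr0 divr1; ring.
rewrite !exprVn !exprS; field.
by rewrite w0 expf_neq0.
Qed.

Lemma is_cderive_czsin1 (R : realType) (j m : nat) (s x : R) : csin s x != 0 ->
  is_cderive s (fun t => czsin j m t x) (dczsin j m s x).
Proof.
move=> w0.
have h := is_cderive_czsin (z := fun t => t +i* x) (w := fun t => csin t x) j m w0
  (is_cderive_line1 s x) (is_cderive_csin1 s x).
apply: is_cderive_eq h _.
by rewrite mulr1.
Qed.

Lemma is_cderive_czsin2 (R : realType) (j m : nat) (s x : R) : csin s x != 0 ->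
  is_cderive x (czsin j m s) ('i%C * dczsin j m s x).
Proof.
move=> w0.
have h := is_cderive_czsin (z := fun t => s +i* t) j m w0
  (is_cderive_line2 s x) (is_cderive_csin2 s x).
apply: is_cderive_eq h _.
by rewrite /dczsin /czsin; ring.
Qed.

(* [(w^-m)' z^j - w^-m (z^j)'] with [w = sin z]: its derivative is
   [(w^-m)'' z^j - w^-m (z^j)''], without mixed terms. *)
Definition wczsin (R : realType) (j m : nat) (s x : R) : R[i] :=
  - (m%:R * (ccos s x * czsin j m.+1 s x) + j%:R * czsin j.-1 m s x).

Definition dwczsin (R : realType) (j m : nat) (s x : R) : R[i] :=
  (m * m.+1)%:R * czsin j m.+2 s x
  - ((m ^ 2)%:R * czsin j m s x + (j * j.-1)%:R * czsin j.-2 m s x).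

(** For [w = sin z], [cos^2 = 1 - sin^2] gives [(w^-m)'' = m (m+1) w^(-m-2) - m^2 w^-m]. No cosine
    survives, so that only integrals of [czsin] itself enter the recurrence. *)
Lemma is_cderive_wczsin2 (R : realType) (j m : nat) (s x : R) : csin s x != 0 ->
  is_cderive x (wczsin j m s) ('i%C * dwczsin j m s x).
Proof.
move=> w0.
have h1 := is_cderive_czsin2 j.-1 m w0.
have h2 := is_cderiveM (is_cderive_ccos2 s x) (is_cderive_czsin2 j m.+1 w0).
have h := is_cderiveD (is_cderiveZ (- m%:R) h2) (is_cderiveZ (- j%:R) h1).
rewrite (_ : wczsin j m s = (fun t =>
  - m%:R * (ccos s t * czsin j m.+1 s t) + - j%:R * czsin j.-1 m s t)); last first.
  by apply/funext => t; rewrite /wczsin opprD !mulNr.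
apply: is_cderive_eq h _; rewrite /dczsin /dwczsin.
have -> : czsin j m s x = csin s x * csin s x * czsin j m.+2 s x.
  by rewrite /czsin !exprS; field; rewrite w0 expf_neq0.
have e1 : czsin j m.+1 s x = csin s x * czsin j m.+2 s x.
  by rewrite /czsin !exprS; field; rewrite w0 expf_neq0.
have hc : ccos s x * ccos s x = 1 - csin s x * csin s x.
  by rewrite -!expr2 -(ccos2Dcsin2 s x); ring.
rewrite !natrM -!natr1 e1.
transitivity ('i%C * (m%:R * (m%:R + 1) * ((ccos s x * ccos s x) * czsin j m.+2 s x)
   + m%:R * (csin s x * csin s x * czsin j m.+2 s x)
   - j%:R * j.-1%:R * czsin j.-2 m s x)).
  by ring.
by rewrite hc; ring.
Qed.

(** * Integrals over the real line *)

(** Up to a constant this is the majorant of the integrands on all the vertical lines; evenness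
    reduces its integral to the arctangent one on the half-line. *)
Lemma integrable_oneDsqrV (R : realType) :
  mu.-integrable setT (fun x : R => ((1 + x ^+ 2)^-1)%:E).
Proof.
have c : continuous (fun x : R => (1 + x ^+ 2)^-1) by exact: continuous_oneDsqrV.
apply/integrableP; split.
  by apply/measurable_EFinP; exact: continuous_measurable_fun.
have p (x : R) : 0 <= (1 + x ^+ 2)^-1 by rewrite invr_ge0 addr_ge0 ?sqr_ge0.
under eq_integral => x _ do rewrite gee0_abs ?lee_fin//.
rewrite ge0_symfun_integralT//; last by move=> x /=; rewrite sqrrN.
rewrite -set_itvcy [X in (_ * X)%E](_ : _ = (pi / 2)%:E) ?ltry//.
exact: integral0y_oneDsqr.
Qed.

Lemma integrable_dominated (R : realType) (f : R -> R) (K : R) :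
  measurable_fun setT f -> (forall x, `|f x| <= K / (1 + x ^+ 2)) ->
  mu.-integrable setT (EFin \o f).
Proof.
move=> mf fK.
apply: (@le_integrable _ _ _ mu setT measurableT _
  (EFin \o (fun x => K * (1 + x ^+ 2)^-1))); first exact/measurable_EFinP.
- by move=> x _; rewrite lee_fin (le_trans (fK x))// ler_norm.
- have := integrableZl measurableT K (@integrable_oneDsqrV R).
  by apply: eq_integrable.
Qed.

(** Dominated convergence for the truncations of [f], with majorant [|f|]. It brings integrals over
    the line down to symmetric compact intervals, where the fundamental theorem and the reflection
    [x -> -x] apply. *)
Lemma cvg_Rintegral_itvNn (R : realType) (f : R -> R) :
  mu.-integrable setT (EFin \o f) ->
  (\int[mu]_(x in `[- n%:R, n%:R]) f x) @[n --> \oo] --> \int[mu]_x f x.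
Proof.
move=> intf.
pose D (n : nat) : set R := `[- n%:R, n%:R]%classic.
have mD n : measurable (D n) by exact: measurable_itv.
have mf : measurable_fun setT (EFin \o f) by exact: measurable_int intf.
have [] := @dominated_convergence _ _ _ mu setT measurableT
  (fun n => EFin \o (f \_ (D n))) (EFin \o f) (abse \o (EFin \o f)).
- move=> n; rewrite -restrict_EFin.
  have [h _] := measurable_restrictT (EFin \o f) (mD n); apply: h.
  exact: measurable_funTS mf.
- exact: mf.
- apply: aeW => x _.
  apply: cvg_near_cst; exists (Num.truncn `|x|).+1 => // n /= hn.
  rewrite patchE mem_set// /D/= in_itv/= -ler_norml.
  by rewrite (le_trans (ltW (truncnS_gt _)))// ler_nat.
- exact: integrable_abse.
- apply: aeW => x n _; rewrite lee_fin patchE; case: ifP => // _.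
  by rewrite normr0.
move=> _ _ h.
have e : (\int[mu]_x (EFin \o f) x)%E = (\int[mu]_x f x)%:E.
  by rewrite fineK//; exact: integrable_fin_num.
rewrite e in h.
rewrite (_ : (fun n => _) = fine \o (fun n => (\int[mu]_x (EFin \o f \_ (D n)) x)%E)).
  exact: fine_cvg h.
by apply/funext => n; rewrite /= Rintegral_mkcond.
Qed.

Lemma Rintegral_derive (R : realType) (F f : R -> R) (l l' : R) :
  (forall x : R, is_derive x 1 F (f x)) -> continuous f ->
  mu.-integrable setT (EFin \o f) ->
  F n%:R @[n --> \oo] --> l -> F (- n%:R) @[n --> \oo] --> l' ->
  \int[mu]_x f x = l - l'.
Proof.
move=> dF cf intf Fl Fl'.
have h := cvg_Rintegral_itvNn intf.
apply: (cvg_unique _ h) => //.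
apply: cvg_trans (cvgB Fl Fl'); apply: near_eq_cvg; near=> n => /=.
have cF : continuous F by move=> x; exact: is_derive1_continuous (dF x).
have n0 : - n%:R < n%:R :> R.
  by rewrite gtrN// ltr0n; near: n; exact: nbhs_infty_gt.
rewrite /Rintegral (@continuous_FTC2 _ f F)//.
- exact: continuous_subspaceT.
- split.
  + by move=> x _; apply: ex_derive.
  + by apply: cvg_at_right_filter; exact: cF.
  + by apply: cvg_at_left_filter; exact: cF.
- by move=> x _; rewrite derive1E derive_val.
Unshelve. all: by end_near. Qed.

Lemma Rintegral_odd (R : realType) (f : R -> R) : continuous f ->
  mu.-integrable setT (EFin \o f) -> (forall x, f (- x) = - f x) ->
  \int[mu]_x f x = 0.
Proof.
move=> cf intf oddf.
have h := cvg_Rintegral_itvNn intf.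
apply: (cvg_unique _ h) => //; apply: cvg_near_cst; near=> n => /=.
have iN : mu.-integrable `[- n%:R, n%:R] (EFin \o f).
  exact: integrableS intf.
have e : \int[mu]_(x in `[- n%:R, n%:R]) f x = \int[mu]_(x in `[- n%:R, n%:R]) (- 1 * f x).
  have nn : - n%:R <= n%:R :> R by rewrite -subr_ge0 opprK addr_ge0.
  have := @integration_by_substitution_oppr R f (- n%:R) n%:R nn.
  rewrite opprK /Rintegral => ->; last exact: continuous_subspaceT.
  by congr fine; apply: eq_integral => x _ /=; rewrite oddf mulN1r.
move: e; rewrite RintegralZl//; lra.
Unshelve. all: by end_near. Qed.

(** * Decay along vertical lines *)

Lemma normr_Re_le (R : rcfType) (z : R[i]) : `|complex.Re z| <= normc z.
Proof.
by case: z => a b /=; rewrite -sqrtr_sqr ler_wsqrtr// lerDl sqr_ge0.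
Qed.

Lemma normr_Im_le (R : rcfType) (z : R[i]) : `|complex.Im z| <= normc z.
Proof.
by case: z => a b /=; rewrite -sqrtr_sqr ler_wsqrtr// lerDr sqr_ge0.
Qed.

Lemma normc_ge0 (R : rcfType) (z : R[i]) : 0 <= normc z.
Proof. by case: z => a b; rewrite sqrtr_ge0. Qed.

Lemma normcX (R : rcfType) (z : R[i]) n : normc (z ^+ n) = normc z ^+ n.
Proof.
by elim: n => [|n ih]; rewrite ?expr0 ?Normc.normc1// !exprS Normc.normcM ih.
Qed.

Lemma normc_le (R : rcfType) (a b r : R) : 0 <= r -> a ^+ 2 + b ^+ 2 <= r ^+ 2 ->
  normc (a +i* b) <= r.
Proof. by move=> r0 h; rewrite -(ger0_norm r0) -sqrtr_sqr ler_wsqrtr. Qed.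

Lemma normc_ge (R : rcfType) (a b r : R) : 0 <= r -> r ^+ 2 <= a ^+ 2 + b ^+ 2 ->
  r <= normc (a +i* b).
Proof. by move=> r0 h; rewrite -(ger0_norm r0) -sqrtr_sqr ler_wsqrtr. Qed.

Lemma normc_nat (R : rcfType) (n : nat) : normc (n%:R : R[i]) = n%:R.
Proof.
rewrite -[n%:R in LHS]mulr_natr mul1r -(rmorph_nat (real_complex R)) /=.
by rewrite expr0n addr0 sqrtr_sqr ger0_norm.
Qed.

Lemma normc_csin_ge (R : realType) (c s x : R) : 0 <= c -> c <= sin s ->
  c * cosh x <= normc (csin s x).
Proof.
move=> c0 cs; have h := cosh_gt0 x.
apply: normc_ge; first by rewrite mulr_ge0// ltW.
rewrite ler_wpDr ?sqr_ge0// (exprMn _ c) (exprMn _ (sin s)) ler_wpM2r ?sqr_ge0//.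
by rewrite ler_pXn2r ?nnegrE// (le_trans c0).
Qed.

Lemma normc_ccos_le (R : realType) (s x : R) : normc (ccos s x) <= cosh x.
Proof.
apply: normc_le; first exact/ltW/cosh_gt0.
rewrite sqrrN (exprMn _ (cos s)) (exprMn _ (sin s)) cos2sin2.
have -> : (1 - sin s ^+ 2) * cosh x ^+ 2 + sin s ^+ 2 * sinh x ^+ 2 =
  cosh x ^+ 2 - sin s ^+ 2 * (cosh x ^+ 2 - sinh x ^+ 2) by ring.
by rewrite cosh2Bsinh2 mulr1 gerBl sqr_ge0.
Qed.

Lemma cosh_dominates (R : realType) (N : nat) :
  exists2 K : R, 0 < K & forall x : R, (1 + x ^+ 2) ^+ N <= K * cosh x.
Proof.
(* From [exp t >= 1 + t^2/2] at [t = |x| / (N+1)]: this makes [1 + x^2 <= M exp t], and the power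
   [N+1] of it brings [exp |x|]. Using [N+1] instead of [N] avoids a division by zero. *)
pose M : R := 2 * N.+1%:R ^+ 2.
have M0 : 0 < M by rewrite mulr_gt0// exprn_gt0.
exists (2 * M ^+ N.+1); first by rewrite mulr_gt0// exprn_gt0.
move=> x.
have h1 : 1 + x ^+ 2 <= M * expR (`|x| / N.+1%:R).
  have := @expR_ge1Dxn R (`|x| / N.+1%:R) 1 (divr_ge0 (normr_ge0 _) (ler0n _ _)).
  rewrite expr_div_n real_normK ?num_real// => h.
  apply: le_trans (ler_wpM2l (ltW M0) h).
  rewrite mulrDr mulr1 lerD//.
    by rewrite /M -natrX -natrM ler1n muln_gt0 expn_gt0.
  rewrite /M (_ : 2`!%:R = 2 :> R)// le_eqVlt; apply/orP; left; apply/eqP.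
  have : N.+1%:R != 0 :> R by rewrite pnatr_eq0.
  by move: (N.+1%:R : R) => v v0; field.
have x1 : 1 <= 1 + x ^+ 2 by rewrite lerDl sqr_ge0.
apply: (@le_trans _ _ ((1 + x ^+ 2) ^+ N.+1)); first exact: ler_weXn2l.
apply: (@le_trans _ _ (M ^+ N.+1 * expR `|x|)).
  rewrite (_ : expR `|x| = expR (`|x| / N.+1%:R) ^+ N.+1); last first.
    by rewrite -expRM_natl mulrC divfK// pnatr_eq0.
  by rewrite -exprMn ler_pXn2r ?nnegrE// ?(le_trans _ x1)// mulr_ge0 ?expR_ge0// ltW.
have := cosh_ge_expR_norm x; rewrite -(ler_pM2l (exprn_gt0 N.+1 M0)).
by lra.
Qed.

(* [sin s] is bounded below by [c], so the line [Re z = s] stays away from the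
   zeros of [sin]. *)
Definition qdecay (R : realType) (c : R) (f : R -> R -> R[i]) :=
  exists K : R, forall s x, `|s| <= 4 -> c <= sin s ->
    normc (f s x) <= K / (1 + x ^+ 2).

Lemma qdecayD (R : realType) (c : R) (f g : R -> R -> R[i]) :
  qdecay c f -> qdecay c g -> qdecay c (fun s x => f s x + g s x).
Proof.
move=> [K hK] [L hL]; exists (K + L) => s x s4 cs.
by rewrite mulrDl (le_trans (le_normcD _ _))// lerD ?hK ?hL.
Qed.

Lemma qdecayN (R : realType) (c : R) (f : R -> R -> R[i]) :
  qdecay c f -> qdecay c (fun s x => - f s x).
Proof. by move=> [K hK]; exists K => s x s4 cs; rewrite normcN hK. Qed.

Lemma qdecayMn (R : realType) (c : R) (n : nat) (f : R -> R -> R[i]) :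
  qdecay c f -> qdecay c (fun s x => n%:R * f s x).
Proof.
move=> [K hK]; exists (n%:R * K) => s x s4 cs.
by rewrite Normc.normcM normc_nat -mulrA ler_wpM2l ?hK.
Qed.

Lemma one_Dsqr_gt0 (R : realFieldType) (x : R) : 0 < 1 + x ^+ 2.
Proof. by rewrite ltr_pwDl// sqr_ge0. Qed.

(** The factor [ccos^b] is at most [cosh^b] and cancels [b] of the [m + b + 1] factors of the
    denominator, each at least [c cosh x]. Of the remaining [cosh^(m+1)] a single [cosh] already
    beats the polynomial growth of [z^j]. *)
Lemma qdecay_czsin_ccos (R : realType) (c : R) (b j m : nat) : 0 < c ->
  qdecay c (fun s x => ccos s x ^+ b * czsin j (m + b).+1 s x).
Proof.
move=> c0; have [K K0 hK] := @cosh_dominates R j.+1.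
exists (4 ^+ j * K / c ^+ (m + b).+1) => s x s4 cs.
have ch := cosh_gt0 x; have x1 := one_Dsqr_gt0 x.
have csn := normc_csin_ge x (ltW c0) cs.
have z4 : normc (s +i* x) <= 4 * (1 + x ^+ 2).
  apply: normc_le; first by rewrite mulr_ge0// ltW.
  have : s ^+ 2 <= 16.
    rewrite -real_normK ?num_real// (_ : 16 = 4 ^+ 2); last by lra.
    by rewrite ler_pXn2r ?nnegrE.
  have := sqr_ge0 x; nra.
rewrite /czsin !Normc.normcM Normc.normcV !normcX.
have := normc_ccos_le s x; have := hK x; have := cosh_ge1 x.
move: (cosh x) ch csn => C C0 csn C1 hKx ccosC.
apply: (@le_trans _ _ (C ^+ b * ((4 * (1 + x ^+ 2)) ^+ j /
    (c * C) ^+ (m + b).+1))).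
  apply: ler_pM; rewrite ?exprn_ge0 ?normc_ge0//.
  - by rewrite mulr_ge0 ?invr_ge0 ?exprn_ge0 ?normc_ge0.
  - by rewrite lerXn2r ?nnegrE ?normc_ge0 ?ccosC// ltW.
  - apply: ler_pM; rewrite ?invr_ge0 ?exprn_ge0 ?normc_ge0//.
      by rewrite lerXn2r ?nnegrE ?normc_ge0// mulr_ge0// ltW.
    rewrite lef_pV2 ?posrE ?exprn_gt0 ?mulr_gt0//.
      by rewrite lerXn2r ?nnegrE ?normc_ge0// mulr_ge0// ltW.
    by rewrite (lt_le_trans _ csn)// mulr_gt0.
have e : C ^+ b * ((4 * (1 + x ^+ 2)) ^+ j / (c * C) ^+ (m + b).+1) =
    (4 ^+ j / c ^+ (m + b).+1) * ((1 + x ^+ 2) ^+ j / C ^+ m.+1).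
  rewrite !exprMn -addSn [C ^+ (m.+1 + b)]exprD; field.
  by rewrite !expf_neq0 ?gt_eqF.
rewrite e (_ : 4 ^+ j * K / c ^+ (m + b).+1 / (1 + x ^+ 2) =
  4 ^+ j / c ^+ (m + b).+1 * (K / (1 + x ^+ 2))); last first.
  by field; rewrite expf_neq0 ?gt_eqF.
apply: ler_wpM2l; first by rewrite divr_ge0 ?exprn_ge0// ltW.
rewrite ler_pdivrMr ?exprn_gt0//.
rewrite mulrAC ler_pdivlMr// -exprSr (le_trans hKx)// ler_wpM2l ?(ltW K0)//.
by rewrite ler_eXnr// C1.
Qed.

Lemma qdecay_czsin (R : realType) (c : R) (j m : nat) : 0 < c ->
  qdecay c (czsin j m.+1).
Proof.
move=> c0; have [K hK] := qdecay_czsin_ccos 0 j m c0.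
by exists K => s x s4 cs; have := hK s x s4 cs; rewrite expr0 mul1r addn0.
Qed.

Lemma qdecay_ccos_czsin (R : realType) (c : R) (j m : nat) : 0 < c ->
  qdecay c (fun s x => ccos s x * czsin j m.+2 s x).
Proof.
move=> c0; have [K hK] := qdecay_czsin_ccos 1 j m c0.
by exists K => s x s4 cs; have := hK s x s4 cs; rewrite expr1 addn1.
Qed.

Lemma qdecay_dczsin (R : realType) (c : R) (j m : nat) : 0 < c ->
  qdecay c (dczsin j m.+1).
Proof.
move=> c0; apply: qdecayD; first exact/qdecayMn/qdecay_czsin.
exact/qdecayN/qdecayMn/qdecay_ccos_czsin.
Qed.

Lemma qdecay_wczsin (R : realType) (c : R) (j m : nat) : 0 < c ->
  qdecay c (wczsin j m.+1).
Proof.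
move=> c0; apply/qdecayN/qdecayD; first exact/qdecayMn/qdecay_ccos_czsin.
exact/qdecayMn/qdecay_czsin.
Qed.

Lemma qdecay_dwczsin (R : realType) (c : R) (j m : nat) : 0 < c ->
  qdecay c (dwczsin j m.+1).
Proof.
move=> c0; apply: qdecayD; first exact/qdecayMn/qdecay_czsin.
by apply/qdecayN/qdecayD; exact/qdecayMn/qdecay_czsin.
Qed.

Lemma csin_neq0 (R : realType) (s x : R) : 0 < sin s -> csin s x != 0.
Proof.
move=> s0; apply/eqP => e.
have := normc_csin_ge x (ltW s0) (lexx _); rewrite e Normc.normc0.
by rewrite leNgt mulr_gt0 ?cosh_gt0.
Qed.

Lemma is_cderive_continuous (R : realType) (f : R -> R[i]) (df : R -> R[i]) :
  (forall x, is_cderive x f (df x)) ->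
  continuous (fun x => complex.Re (f x)) /\ continuous (fun x => complex.Im (f x)).
Proof.
move=> h; split => x.
- exact: (is_derive1_continuous (h x).1).
- exact: (is_derive1_continuous (h x).2).
Qed.

Lemma continuous_Re_czsin (R : realType) (j m : nat) (s : R) : 0 < sin s ->
  continuous (fun x => complex.Re (czsin j m s x)).
Proof.
move=> s0.
exact: (is_cderive_continuous (fun x => is_cderive_czsin2 j m (csin_neq0 x s0))).1.
Qed.

Lemma continuous_Re_dczsin (R : realType) (j m : nat) (s : R) : 0 < sin s ->
  continuous (fun x => complex.Re (dczsin j m s x)).
Proof.
move=> s0.
have e : dczsin j m s = (fun x => j%:R * czsin j.-1 m s x +
    - m%:R * (ccos s x * czsin j m.+1 s x)).
  by apply/funext => x; rewrite mulNr.
rewrite e.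
apply: (is_cderive_continuous (fun x => is_cderiveD
  (is_cderiveZ j%:R (is_cderive_czsin2 j.-1 m (csin_neq0 x s0)))
  (is_cderiveZ (- m%:R) (is_cderiveM (is_cderive_ccos2 s x)
     (is_cderive_czsin2 j m.+1 (csin_neq0 x s0)))))).1.
Qed.

Lemma Re_natM (R : rcfType) (n : nat) (z : R[i]) :
  complex.Re (n%:R * z) = n%:R * complex.Re z.
Proof.
rewrite -(rmorph_nat (real_complex R)); case: z => a b /=.
by rewrite mul0r subr0.
Qed.

Lemma ReD (R : rcfType) (z w : R[i]) :
  complex.Re (z + w) = complex.Re z + complex.Re w.
Proof. by case: z; case: w. Qed.

Lemma ReN (R : rcfType) (z : R[i]) : complex.Re (- z) = - complex.Re z.
Proof. by case: z. Qed.

Lemma Im_iM (R : rcfType) (z : R[i]) : complex.Im ('i%C * z) = complex.Re z.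
Proof. by case: z => a b /=; rewrite mul0r add0r mul1r. Qed.

Lemma Re_dwczsin (R : realType) (j m : nat) (s x : R) :
  complex.Re (dwczsin j m s x) = (m * m.+1)%:R * complex.Re (czsin j m.+2 s x)
  - ((m ^ 2)%:R * complex.Re (czsin j m s x)
     + (j * j.-1)%:R * complex.Re (czsin j.-2 m s x)).
Proof. by rewrite /dwczsin ReD ReN ReD !Re_natM. Qed.

Lemma continuous_Re_dwczsin (R : realType) (j m : nat) (s : R) : 0 < sin s ->
  continuous (fun x => complex.Re (dwczsin j m s x)).
Proof.
move=> s0 x; under eq_fun do rewrite Re_dwczsin.
apply: cvgB; last apply: cvgD; apply: cvgMr; exact: continuous_Re_czsin.
Qed.

Lemma integrable_qdecay (R : realType) (f : R -> R -> R[i]) (s : R) :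
  qdecay (sin s) f -> `|s| <= 4 ->
  continuous (fun x => complex.Re (f s x)) ->
  mu.-integrable setT (EFin \o (fun x => complex.Re (f s x))).
Proof.
move=> [K hK] s4 cf; apply: (@integrable_dominated _ _ K).
  exact: continuous_measurable_fun.
by move=> x; rewrite (le_trans (normr_Re_le _))// hK.
Qed.

Lemma cvgn_oneDsqrV (R : realType) (K : R) :
  K / (1 + n%:R ^+ 2) @[n --> \oo] --> (0 : R).
Proof.
apply: norm_cvg0.
have h : (2 * `|K|) * harmonic n @[n --> \oo] --> (0 : R).
  by rewrite -[0](mulr0 (2 * `|K|)); apply: cvgMr; exact: cvg_harmonic.
apply: (@squeeze_cvgr _ _ _ _ (cst 0) _ _ _ _ _ h); last exact: cvg_cst.
apply: nearW => n; rewrite normr_ge0/= normrM normfV (ger0_norm (ltW (one_Dsqr_gt0 _))).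
rewrite [2 * _]mulrC -mulrA ler_wpM2l// /harmonic ler_pdivlMr//.
rewrite ler_pdivrMl ?one_Dsqr_gt0// -natr1.
have := sqr_ge0 (n%:R - 1 : R); have := ler0n R n; nra.
Qed.

(** Since [f' = i g], the real function [Im f] is a primitive of [Re g], and the decay of [f] makes
    it vanish at both ends. *)
Lemma Rintegral_cderive (R : realType) (f g : R -> R -> R[i]) (s : R) :
  `|s| <= 4 -> qdecay (sin s) f -> qdecay (sin s) g ->
  (forall x, is_cderive x (f s) ('i%C * g s x)) ->
  continuous (fun x => complex.Re (g s x)) ->
  \int[mu]_x complex.Re (g s x) = 0.
Proof.
move=> s4 [K hK] gq fg cg; rewrite -[RHS](subrr 0).
apply: (@Rintegral_derive _ (fun x => complex.Im (f s x))) => //.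
- by move=> x; rewrite -Im_iM; exact: (fg x).2.
- exact: integrable_qdecay.
- apply: norm_cvg0; apply: (@squeeze_cvgr _ _ _ _ (cst 0)); [|exact: cvg_cst|exact: (@cvgn_oneDsqrV _ K)].
  by apply: nearW => n; rewrite normr_ge0/= (le_trans (normr_Im_le _)) ?hK.
- apply: norm_cvg0; apply: (@squeeze_cvgr _ _ _ _ (cst 0)); [|exact: cvg_cst|exact: (@cvgn_oneDsqrV _ K)].
  apply: nearW => n; rewrite normr_ge0/= (le_trans (normr_Im_le _))//.
  by rewrite (le_trans (hK _ _ _ _))// sqrrN.
Qed.

(** Integral of the derivative of [wczsin]. For [j < 2] the truncated index [j.-2] is harmless, its
    coefficient [j (j-1)] being zero. *)
Lemma Rintegral_czsin_rec (R : realType) (j m : nat) (s : R) :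
  `|s| <= 4 -> 0 < sin s ->
  (m.+1 * m.+2)%:R * \int[mu]_x complex.Re (czsin j m.+3 s x) =
  (m.+1 ^ 2)%:R * \int[mu]_x complex.Re (czsin j m.+1 s x) +
  (j * j.-1)%:R * \int[mu]_x complex.Re (czsin j.-2 m.+1 s x).
Proof.
move=> s4 s0.
have i1 j' m' : mu.-integrable setT (EFin \o (fun x => complex.Re (czsin j' m'.+1 s x))).
  by apply: integrable_qdecay => //; [exact: qdecay_czsin|exact: continuous_Re_czsin].
have iZ j' m' (r : R) : mu.-integrable setT
    (EFin \o (fun x => r * complex.Re (czsin j' m'.+1 s x))).
  have := integrableZl measurableT r (i1 j' m').
  by apply: eq_integrable.
have : \int[mu]_x complex.Re (dwczsin j m.+1 s x) = 0.
  apply: (Rintegral_cderive (f := wczsin j m.+1)) => //.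
  - exact: qdecay_wczsin.
  - exact: qdecay_dwczsin.
  - by move=> x; apply: is_cderive_wczsin2; exact: csin_neq0.
  - exact: continuous_Re_dwczsin.
under eq_Rintegral do rewrite Re_dwczsin.
rewrite RintegralB//.
- rewrite RintegralD// !RintegralZl//; lra.
- have := integrableD measurableT (iZ j m (m.+1 ^ 2)%:R) (iZ j.-2 m (j * j.-1)%:R).
  by apply: eq_integrable.
Qed.

(** * Shifting the line of integration *)

Lemma Rintegral_dczsin (R : realType) (j m : nat) (s : R) : `|s| <= 4 ->
  0 < sin s -> \int[mu]_x complex.Re (dczsin j m.+1 s x) = 0.
Proof.
move=> s4 s0; apply: (Rintegral_cderive (f := czsin j m.+1)) => //.
- exact: qdecay_czsin.
- exact: qdecay_dczsin.
- by move=> x; apply: is_cderive_czsin2; exact: csin_neq0.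
- exact: continuous_Re_dczsin.
Qed.

Lemma is_derive_Rintegral_czsin (R : realType) (j m : nat) (lo hi s : R) :
  0 < lo -> lo < s < hi -> hi < pi ->
  is_derive s 1 (fun t => \int[mu]_x complex.Re (czsin j m.+1 t x)) 0.
Proof.
move=> lo0 /andP[los shi] hipi.
(* The minimum [sin c0 > 0] of the sine over the closed interval is the constant given to [qdecay]:
   it yields one majorant for all [t] in the open interval. *)
have [c0 + hc0] : exists2 c, c \in `[lo, hi] & forall t, t \in `[lo, hi] -> sin c <= sin t.
  apply: EVT_min; first exact/ltW/(lt_trans los).
  exact/continuous_subspaceT/continuous_sin.
rewrite in_itv/= => /andP[loc chi].
have s0 : 0 < sin c0 by apply: sin_gt0_pi; rewrite (lt_le_trans lo0)//= (le_lt_trans chi).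
have pi4 : pi < 4 :> R by have := @pihalf_lt2 R; lra.
have inI t : `]lo, hi[%classic t -> `|t| <= 4 /\ sin c0 <= sin t.
  rewrite /= in_itv/= => /andP[lot thi]; split.
    by rewrite ger0_norm ?(ltW (lt_trans lo0 lot))//; lra.
  by apply: hc0; rewrite in_itv/= !ltW.
have sI t : `]lo, hi[%classic t -> 0 < sin t.
  by move=> /inI[_]; exact: lt_le_trans.
have Is : `]lo, hi[%classic s by rewrite /= in_itv/= los.
have [K hK] := qdecay_dczsin j m s0.
have dRe t x : `]lo, hi[%classic t ->
    is_derive t 1 (fun u => complex.Re (czsin j m.+1 u x))
      (complex.Re (dczsin j m.+1 t x)).
  by move=> /sI t0; exact: (is_cderive_czsin1 j m.+1 (csin_neq0 x t0)).1.
have K0 : 0 <= K.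
  have [s4 cs] := inI _ Is; have := le_trans (normc_ge0 _) (hK s 0 s4 cs).
  by rewrite expr0n addr0 divr1.
have intf t : `]lo, hi[%classic t ->
    mu.-integrable setT (EFin \o (fun x => complex.Re (czsin j m.+1 t x))).
  move=> It; have [t4 _] := inI t It; apply: integrable_qdecay => //.
    exact/qdecay_czsin/sI.
  exact/continuous_Re_czsin/sI.
have derf t x : `]lo, hi[%classic t -> setT x ->
    derivable (fun u => complex.Re (czsin j m.+1 u x)) t 1.
  by move=> It _; have := dRe t x It => -[].
have G0 (x : R) : 0 <= K / (1 + x ^+ 2) by rewrite divr_ge0// ltW// one_Dsqr_gt0.
have intG : mu.-integrable setT (EFin \o (fun x : R => K / (1 + x ^+ 2))).
  by have := integrableZl measurableT K (@integrable_oneDsqrV R); exact: eq_integrable.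
have G_ub t x : `]lo, hi[%classic t -> setT x ->
    `|partial1of2 (fun u y => complex.Re (czsin j m.+1 u y)) t x| <= K / (1 + x ^+ 2).
  move=> It _; have [t4 ct] := inI t It.
  rewrite partial1of2E; have [_ ->] := dRe t x It.
  by rewrite (le_trans (normr_Re_le _))// hK.
have h := derivable_under_integral measurableT Is intf derf G0 intG G_ub.
have h' := differentiation_under_integral measurableT Is intf derf G0 intG G_ub.
apply: DeriveDef; first exact: h.
rewrite -derive1E h'.
under eq_Rintegral => x _.
  rewrite partial1of2E; have [_ ->] := dRe s x Is. over.
apply: Rintegral_dczsin; [exact: (inI _ Is).1|exact: sI].
Qed.

Lemma Rintegral_czsin_shift (R : realType) (j m : nat) (s : R) :
  0 < s <= pi / 2 ->
  \int[mu]_x complex.Re (czsin j m.+1 s x) =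
  \int[mu]_x complex.Re (czsin j m.+1 (pi / 2) x).
Proof.
move=> /andP[s0 spi]; have pi0 := @pi_gt0 R.
pose J (t : R) := \int[mu]_x complex.Re (czsin j m.+1 t x).
rewrite -[LHS]/(J s) -[RHS]/(J (pi / 2)).
have d (t : R) : t \in `[s, pi / 2] -> is_derive t 1 J 0.
  rewrite in_itv/= => /andP[st tpi].
  (* The margins [s/2] and [3 pi/4] surround every point of [[s, pi/2]] by an open interval whose
     closure lies in []0, pi[]. *)
  by apply: (@is_derive_Rintegral_czsin _ _ _ (s / 2) (3 * pi / 4)); lra.
have cJ : {within `[s, pi / 2], continuous J}.
  by apply: derivable_within_continuous => x xs; have [] := d x xs.
have dJ (x : R) : x \in `]s, (pi / 2)[ -> is_derive x 1 J (cst 0 x).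
  by move=> xs; apply: d; apply: subset_itv_oo_cc.
move: J cJ dJ {d} => J cJ dJ.
have [c _ e] := MVT_segment spi dJ cJ.
by apply/esym/eqP; rewrite -subr_eq0 e mul0r.
Qed.

Lemma sqr_le_sinh (R : realType) (x : R) : x ^+ 2 <= sinh x ^+ 2.
Proof.
have h (y : R) : 0 <= y -> y ^+ 2 <= sinh y ^+ 2.
  move=> y0; have y3 : 0 <= y ^+ 3 by rewrite exprn_ge0.
  have ys : y <= sinh y by apply: le_trans (sinh_ge y0); lra.
  by rewrite ler_pXn2r ?nnegrE// (le_trans y0).
have [x0|x0] := leP 0 x; first exact: h.
by rewrite -sqrrN -[leRHS]sqrrN -sinhN h// oppr_ge0 ltW.
Qed.

Lemma sinh_eq0 (R : realType) (x : R) : (sinh x == 0) = (x == 0).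
Proof.
apply/idP/idP => [/eqP e|/eqP ->]; last by rewrite sinh0.
have := sqr_le_sinh x; rewrite e expr0n => h.
by rewrite -sqrf_eq0 eq_le h sqr_ge0.
Qed.

(** Integrates [sin y <= y] to [cos y >= 1 - y^2/2 >= 1/2], then integrates again. It makes [s] and
    [sin s] comparable as [s] tends to [0]. *)
Lemma half_le_sin (R : realType) (x : R) : 0 <= x <= 1 -> x / 2 <= sin x.
Proof.
have s1 (y : R) : 0 <= y <= 1 -> sin y <= y.
  apply: (@is_derive_le R 1 (@sin R) id (@cos R) (cst 1)) => //.
  - by rewrite sin0.
  - by move=> z _; exact: cos_le1.
have c2 (y : R) : 0 <= y <= 1 -> 1 + - 2^-1 * y ^+ 2 <= cos y.
  apply: (@is_derive_le R 1 (fun y => 1 + - 2^-1 * y ^+ 2) (@cos R) -%R (fun y => - sin y)) => //.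
  - move=> z; apply: is_derive_eq (is_deriveD (is_derive_cst (1 : R) z 1)
      (is_derive_polyn 2 _ z)) _.
    by rewrite /= expr1; field.
  - by rewrite cos0 expr0n mulr0 addr0.
  - by move=> z hz; rewrite lerN2 s1.
suff : forall y : R, 0 <= y <= 1 -> 2^-1 * y ^+ 1 <= sin y.
  by move=> h x01; have := h _ x01; rewrite expr1 mulrC.
apply: (@is_derive_le R 1 (fun y => 2^-1 * y ^+ 1) (@sin R) (cst 2^-1) (@cos R)) => //.
- move=> z; apply: is_derive_eq (is_derive_polyn 1 _ z) _.
  by rewrite /= expr0; ring.
- by rewrite sin0 mulr0.
- move=> z z01; apply: le_trans (c2 _ z01); case/andP: z01 => z0 z1 /=.
  by have : z ^+ 2 <= 1 by [rewrite expr_le1]; lra.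
Qed.

Definition xdivsinh (R : realType) (x : R) : R :=
  if x == 0 then 1 else x / sinh x.

Lemma continuous_xdivsinh (R : realType) : continuous (@xdivsinh R).
Proof.
move=> x; have [->|x0] := eqVneq x 0.
  (* Caratheodory's form of the derivative at [0]: [sinh y = g y * y] with [g] continuous at [0] and
     [g 0 = cosh 0 = 1], so [xdivsinh] is [1 / g] and continuity at the removable singularity
     follows. *)
  have [g [hg cg g0]] := (is_derive1_caratheodory _ _ _).1 (is_derive_sinh (0 : R)).
  rewrite cosh0 in g0.
  have -> : @xdivsinh R = (fun x => (g x)^-1).
    apply/funext => y; rewrite /xdivsinh; case: eqVneq => [->|y0].
      by rewrite g0 invr1.
    by have := hg y; rewrite sinh0 !subr0 => ->; field; rewrite y0/=;
      have := sinh_eq0 y; have := hg y; rewrite sinh0 !subr0 => ->;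
      rewrite mulf_eq0 (negbTE y0) orbF => ->.
  by apply: cvgV => //; rewrite g0 oner_eq0.
have h : {for x, continuous (fun y : R => y / sinh y)}.
  apply: cvgM; first exact: cvg_id.
  by apply: cvgV; [rewrite sinh_eq0|exact: continuous_sinh].
rewrite /continuous_at {2}/xdivsinh (negbTE x0).
apply: cvg_trans h; apply: near_eq_cvg; near=> y.
rewrite /xdivsinh ifN//; near: y.
exact: cvgr_neq0 cvg_id x0.
Unshelve. all: by end_near. Qed.

Lemma xdivsinh_gt0 (R : realType) (x : R) : 0 < xdivsinh x.
Proof.
have h (y : R) : 0 < y -> 0 < y / sinh y.
  move=> y0; rewrite divr_gt0//; apply: lt_le_trans (sinh_ge (ltW y0)).
  by rewrite addr_gt0// divr_gt0// exprn_gt0.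
rewrite /xdivsinh; case: eqVneq => // x0.
have [|x1] := ltP 0 x; first exact: h.
by have := h (- x); rewrite oppr_gt0 sinhN invrN mulrNN; apply; rewrite lt_neqAle x0.
Qed.

(** On the imaginary axis [sin (ix) = i sinh x], and the powers of [i] in [z^m] and [(sin z)^m]
    cancel. *)
Lemma czsin_0 (R : realType) (q m : nat) (x : R) : x != 0 ->
  czsin (m + q) m 0 x = (0 +i* x) ^+ q * ((xdivsinh x) ^+ m)%:C.
Proof.
move=> x0; rewrite /czsin /csin sin0 cos0 mul0r mul1r /xdivsinh (negbTE x0).
have e : 0 +i* x = 'i%C * x%:C by apply/eqP; rewrite eq_complex /=; apply/andP; split; apply/eqP; ring.
have -> : 0 +i* sinh x = 'i%C * (sinh x)%:C.
  by apply/eqP; rewrite eq_complex /=; apply/andP; split; apply/eqP; ring.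
have s0 : (sinh x)%:C != 0 by rewrite fmorph_eq0 sinh_eq0.
have i0 : 'i%C != 0 :> R[i] by rewrite eq_complex /= oner_eq0 andbF.
move: (sinh x) s0 => S s0.
rewrite e exprD rmorphXn /= (_ : (x / S)%:C = x%:C / S%:C); last first.
  by rewrite rmorphM fmorphV.
by rewrite !exprMn exprVn; field; rewrite !expf_neq0.
Qed.

(* The bound is uniform as [s] tends to [0] because the zero of [z^(m+1+q)] at [0]
   cancels the one of [(sin z)^(m+1)]. *)
Lemma normc_czsin_le (R : realType) (q m : nat) :
  exists K : R, forall s x, 0 < s <= 1 ->
    normc (czsin (m.+1 + q) m.+1 s x) <= K / (1 + x ^+ 2).
Proof.
have [K K0 hK] := @cosh_dominates R (m.+1 + q).+1.
exists (2 ^+ (m.+1 + q) * K) => s x /andP[s0 s1].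
have ch := cosh_gt0 x; have x1 := one_Dsqr_gt0 x.
have ss : s / 2 <= sin s by apply: half_le_sin; rewrite ltW.
have s2 : s ^+ 2 <= 4 * sin s ^+ 2 by nra.
have w0 : csin s x != 0 by apply: csin_neq0; nra.
have nz : normc (s +i* x) <= 2 * (1 + x ^+ 2).
  apply: normc_le; first by rewrite mulr_ge0// ltW.
  have := sqr_ge0 x; nra.
(* This bounds [z / sin z] by [2 (1 + x^2) / cosh x], independently of [s]. It is checked on
   squares, with [|sin z|^2 = sin^2 s + sinh^2 x], from [s^2 <= 4 sin^2 s] and [x^2 <= sinh^2 x]. *)
have nzw : normc (s +i* x) * cosh x <= 2 * (1 + x ^+ 2) * normc (csin s x).
  rewrite -(@ler_pXn2r _ 2%N) ?nnegrE ?mulr_ge0 ?normc_ge0 ?(ltW x1) ?(ltW ch)//.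
  rewrite [leLHS]exprMn [leRHS]exprMn [(2 * _) ^+ 2]exprMn.
  rewrite !sqr_sqrtr ?addr_ge0 ?sqr_ge0//.
  rewrite (exprMn _ (sin s)) (exprMn _ (cos s)) cos2sin2.
  have hs := sqr_le_sinh x; have hc := cosh2Bsinh2 x; have X0 := sqr_ge0 x.
  have S0 := sqr_ge0 (sin s).
  have s12 : s ^+ 2 <= 1 by rewrite expr_le1// ltW.
  move: (cosh x ^+ 2) (sinh x ^+ 2) (sin s ^+ 2) (x ^+ 2) (s ^+ 2) s2 hs hc X0 S0 s12.
  move=> C H S X T TS XH CH X0 S0 T1.
  have -> : C = H + 1 by lra.
  have -> : S * (H + 1) + (1 - S) * H = S + H by ring.
  have H0 : 0 <= H by exact: le_trans XH.
  have h1 : T * H <= H by rewrite ler_piMl.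
  have XH0 : 0 <= X * H by rewrite mulr_ge0.
  have XS0 : 0 <= X * S by rewrite mulr_ge0.
  have XXH0 : 0 <= X ^+ 2 * (S + H) by rewrite mulr_ge0 ?sqr_ge0 ?addr_ge0.
  nra.
have N0 : 0 < normc (csin s x).
  by rewrite lt_neqAle normc_ge0 andbT eq_sym; apply: contra w0 => /eqP/Normc.eq0_normc ->.
rewrite /czsin exprD mulrAC -expr_div_n Normc.normcM !normcX Normc.normcM Normc.normcV.
move: (normc (csin s x)) (normc (s +i* x)) (normc_ge0 (s +i* x)) nz nzw N0 => W Z Z0 nz nzw W0.
have C1 := cosh_ge1 x; have hKx := hK x.
move: (cosh x) ch nzw C1 hKx => C C0 nzw C1 hKx.
set X := 1 + x ^+ 2 in x1 nz nzw hKx *.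
have ZW : Z / W <= 2 * X / C by rewrite ler_pdivrMr// mulrAC ler_pdivlMr.
apply: (@le_trans _ _ ((2 * X / C) ^+ m.+1 * (2 * X) ^+ q)).
  apply: ler_pM; rewrite ?exprn_ge0//; first by rewrite divr_ge0// ltW.
    by rewrite lerXn2r ?nnegrE// ?divr_ge0 ?mulr_ge0// ltW.
  by rewrite lerXn2r ?nnegrE// mulr_ge0// ltW.
have -> : (2 * X / C) ^+ m.+1 * (2 * X) ^+ q =
    2 ^+ (m.+1 + q) * (X ^+ (m.+1 + q) / C ^+ m.+1).
  by rewrite !exprMn !exprD exprVn; ring.
rewrite -mulrA ler_wpM2l ?exprn_ge0// ler_pdivlMr//.
rewrite mulrAC -exprSr ler_pdivrMr ?exprn_gt0//.
by rewrite (le_trans hKx)// ler_wpM2l ?(ltW K0)// ler_eXnr.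
Qed.

Lemma Re_mulCr (R : rcfType) (z : R[i]) (r : R) :
  complex.Re (z * r%:C) = complex.Re z * r.
Proof. by case: z => a b /=; rewrite mulr0 subr0. Qed.

Lemma continuous_Re_xdivsinh (R : realType) (q m : nat) :
  continuous (fun x : R => complex.Re ((0 +i* x) ^+ q * ((xdivsinh x) ^+ m)%:C)).
Proof.
under eq_fun do rewrite Re_mulCr.
move=> x; apply: cvgM.
  exact: (is_cderive_continuous (fun x => is_cderiveX q (is_cderive_line2 (0 : R) x))).1.
apply: (@continuous_cvg _ _ _ _ _ (@xdivsinh R) (fun y : R => y ^+ m)); [exact: exprn_continuous|exact: continuous_xdivsinh].
Qed.

(** The integrals over the lines [s = 1/(k+1)] all equal the one over [pi/2], so their limit as [k]
    grows, given by dominated convergence, is that same number. Integrability of the limit comes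
    with it. *)
Lemma Rintegral_czsin_0 (R : realType) (q m : nat) :
  mu.-integrable setT
    (EFin \o (fun x : R => complex.Re ((0 +i* x) ^+ q * ((xdivsinh x) ^+ m.+1)%:C))) /\
  \int[mu]_x complex.Re (czsin (m.+1 + q) m.+1 (pi / 2 : R) x) =
  \int[mu]_x complex.Re ((0 +i* x) ^+ q * ((xdivsinh x) ^+ m.+1)%:C).
Proof.
have [K hK] := normc_czsin_le R q m.
pose s_ (k : nat) : R := k.+1%:R^-1.
have s01 k : 0 < s_ k <= 1 by rewrite invr_gt0 ltr0n/= invf_le1// ler1n.
have sins k : 0 < sin (s_ k).
  have /andP[h0 h1] := s01 k.
  by apply: lt_le_trans (half_le_sin (x := s_ k) _); rewrite ?(ltW h0)// divr_gt0.
have cf k : continuous (fun x => complex.Re (czsin (m.+1 + q) m.+1 (s_ k) x)).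
  exact: continuous_Re_czsin.
pose g (x : R) := complex.Re ((0 +i* x) ^+ q * ((xdivsinh x) ^+ m.+1)%:C).
have mg : measurable_fun setT (EFin \o g).
  apply/measurable_EFinP; apply: continuous_measurable_fun.
  exact: (@continuous_Re_xdivsinh R q m.+1).
have [] := @dominated_convergence _ _ _ mu setT measurableT
  (fun k => EFin \o (fun x => complex.Re (czsin (m.+1 + q) m.+1 (s_ k) x)))
  (EFin \o g) (EFin \o (fun x : R => K / (1 + x ^+ 2))).
- by move=> k; apply/measurable_EFinP; exact: continuous_measurable_fun.
- exact: mg.
(* At [x = 0] the limiting denominator [csin 0 0] is zero; pointwise convergence is claimed off this
   null set. *)
- exists [set 0]; split; [exact: measurable_set1|exact: lebesgue_measure_set1|].
  move=> x /= /not_implyP[_ hx]; apply: contrapT => /eqP x0; apply: hx.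
  have w0 : csin 0 x != 0.
    by rewrite /csin sin0 cos0 mul0r mul1r eq_complex /= eqxx sinh_eq0.
  apply: cvg_EFin; first exact: nearW.
  rewrite /g -czsin_0//.
  apply: (cvg_comp s_ (fun s => complex.Re (czsin (m.+1 + q) m.+1 s x))).
    exact: cvg_harmonic.
  exact: (is_derive1_continuous (is_cderive_czsin1 (m.+1 + q) m.+1 w0).1).
- by have := integrableZl measurableT K (@integrable_oneDsqrV R); exact: eq_integrable.
- apply: aeW => x k _; rewrite lee_fin (le_trans (normr_Re_le _))// hK//.
move=> ig _ h.
have intf k : mu.-integrable setT
    (EFin \o (fun x => complex.Re (czsin (m.+1 + q) m.+1 (s_ k) x))).
  apply: (@integrable_dominated _ _ K).
    exact: continuous_measurable_fun.
  by move=> x; rewrite (le_trans (normr_Re_le _))// hK.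
have e k : fine (\int[mu]_x (EFin \o (fun x =>
    complex.Re (czsin (m.+1 + q) m.+1 (s_ k) x))) x)%E
   = \int[mu]_x complex.Re (czsin (m.+1 + q) m.+1 (pi / 2 : R) x).
  have /andP[h0 h1] := s01 k.
  rewrite -(Rintegral_czsin_shift _ _ (s := s_ k))// h0 (le_trans h1)//.
  exact: pihalf_ge1.
split; first exact: ig.
rewrite -[RHS]/(fine (\int[mu]_x (EFin \o g) x)%E).
have /fine_cvg : (\int[mu]_x (EFin \o (fun x => complex.Re (czsin (m.+1 + q) m.+1 (s_ k) x))) x)%E
    @[k --> \oo] --> (fine (\int[mu]_x (EFin \o g) x)%E)%:E.
  by rewrite fineK//; exact: integrable_fin_num.
rewrite /comp; under eq_fun do rewrite e.
by move=> h'; apply: (cvg_unique _ _ h') => //; exact: cvg_cst.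
Qed.

(** * The limit of the integrals on the imaginary axis *)

Lemma cvgn_natV (R : realType) : (n%:R : R)^-1 @[n --> \oo] --> (0 : R).
Proof.
apply/(@gtr0_cvgV0 _ _ _ _ (fun n : nat => n%:R)); last exact: cvgr_idn.
by exists 1%N => // n /=; rewrite ltr0n.
Qed.

Lemma bernoulli_le (R : realDomainType) (x : R) n : 0 <= x ->
  1 + n%:R * x <= (1 + x) ^+ n.
Proof.
move=> x0; elim: n => [|n ih]; first by rewrite mul0r addr0.
rewrite exprS; apply: (@le_trans _ _ ((1 + x) * (1 + n%:R * x))).
  rewrite -natr1; have : 0 <= x * (n%:R * x) by rewrite !mulr_ge0.
  by lra.
by rewrite ler_wpM2l// addr_ge0.
Qed.

(** Provides a majorant of [(1 + t/M)^(-M)] that does not depend on [M]. With [k = M %/ N >= 1] one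
    has [M <= 2 N k], so Bernoulli gives [1 + t <= 2 N (1 + k t/M) <= 2 N (1 + t/M)^k]; the power
    [N] of this concludes since [k N <= M]. *)
Lemma expr_1Ddiv_ge (R : realFieldType) (t : R) (N M : nat) : 0 <= t ->
  (0 < N <= M)%N -> (1 + t) ^+ N <= (2 * N%:R) ^+ N * (1 + t / M%:R) ^+ M.
Proof.
move=> t0 /andP[N0 NM]; pose k := (M %/ N)%N.
have k0 : (0 < k)%N by rewrite divn_gt0.
have Mk : (M <= k * (2 * N))%N.
  by have := divn_eq M N; have := ltn_pmod M N0; rewrite -/k; nia.
have M0 : 0 < M%:R :> R by rewrite ltr0n (leq_trans N0).
have tM : 0 <= t / M%:R by rewrite divr_ge0// ltW.
have N2 : 0 < 2 * N%:R :> R by rewrite mulr_gt0// ltr0n.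
apply: (@le_trans _ _ ((2 * N%:R) ^+ N * ((1 + t / M%:R) ^+ k) ^+ N)); last first.
  rewrite ler_wpM2l ?exprn_ge0// ?(ltW N2)// -exprM ler_weXn2l ?lerDl//.
  exact: leq_trunc_div.
rewrite -exprMn lerXn2r ?nnegrE ?addr_ge0//.
  by rewrite mulr_ge0 ?exprn_ge0 ?addr_ge0// ltW.
apply: (@le_trans _ _ (2 * N%:R * (1 + k%:R * (t / M%:R)))); last first.
  by rewrite ler_wpM2l ?(ltW N2)// bernoulli_le.
rewrite mulrDr mulr1 lerD//.
  by rewrite -natrM ler1n muln_gt0.
have -> : 2 * N%:R * (k%:R * (t / M%:R)) = t * ((k * (2 * N))%:R / M%:R).
  by rewrite !natrM; ring.
by rewrite ler_peMr// ler_pdivlMr// mul1r ler_nat.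
Qed.

Lemma xdivsinhN (R : realType) (x : R) : xdivsinh (- x) = xdivsinh x.
Proof. by rewrite /xdivsinh oppr_eq0 sinhN invrN mulrNN. Qed.

Lemma xdivsinh_norm (R : realType) (x : R) : xdivsinh `|x| = xdivsinh x.
Proof. by case: (ger0P x) => // _; rewrite xdivsinhN. Qed.

Lemma xdivsinh_le (R : realType) (x : R) : xdivsinh x <= (1 + x ^+ 2 / 6)^-1.
Proof.
rewrite -xdivsinh_norm -(real_normK (num_real x)).
have := normr_ge0 x; move: `|x| => y y0.
rewrite /xdivsinh; case: eqVneq => [->|yn0]; first by rewrite expr0n mul0r addr0 invr1.
have {yn0}y0 : 0 < y by rewrite lt_neqAle eq_sym yn0.
have h := sinh_ge (ltW y0).
have s0 : 0 < sinh y by apply: lt_le_trans h; rewrite addr_gt0// divr_gt0// exprn_gt0.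
rewrite ler_pdivrMr// ler_pdivlMl; last by rewrite ltr_pwDl// divr_ge0// sqr_ge0.
by apply: le_trans h; rewrite le_eqVlt; apply/orP; left; apply/eqP; ring.
Qed.

(** Follows from [sinh_le] and [exp u >= 1 + u]. It agrees with the bound of [xdivsinh_le] to order
    [x^2], and its exponential form makes the power [M] explicit. *)
Lemma xdivsinh_ge (R : realType) (x : R) : x ^+ 2 <= 1 ->
  expR (- (x ^+ 2 / 6 + 3 * x ^+ 4)) <= xdivsinh x.
Proof.
rewrite -xdivsinh_norm -(real_normK (num_real x)) (_ : x ^+ 4 = `|x| ^+ 4); last first.
  by rewrite -[4%N]/(2 * 2)%N exprM -(real_normK (num_real x)) -exprM.
have := normr_ge0 x; move: `|x| => y y0 y1.
have {}y1 : y <= 1 by rewrite -(@expr_le1 _ 2%N).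
rewrite /xdivsinh; case: eqVneq => [->|yn0].
  by rewrite !expr0n mul0r mulr0 addr0 oppr0 expR0.
have {yn0}y0 : 0 < y by rewrite lt_neqAle eq_sym yn0.
have s0 : 0 < sinh y.
  by apply: lt_le_trans (sinh_ge (ltW y0)); rewrite addr_gt0// divr_gt0// exprn_gt0.
have h : sinh y <= y + y ^+ 3 / 6 + 3 * y ^+ 5 by apply: sinh_le; rewrite (ltW y0).
rewrite expRN ler_pdivlMr// ler_pdivrMl ?expR_gt0//.
apply: (le_trans h).
have := expR_ge1Dx (y ^+ 2 / 6 + 3 * y ^+ 4); rewrite -(ler_pM2r y0).
apply: le_trans; rewrite le_eqVlt; apply/orP; left; apply/eqP; ring.
Qed.

Lemma cvg_xdivsinh_expn (R : realType) (v : R) :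
  xdivsinh (Num.sqrt (6 / M%:R) * v) ^+ M @[M --> \oo] --> expR (- v ^+ 2).
Proof.
pose t := v ^+ 2.
have t0 : 0 <= t by exact: sqr_ge0.
have tM : t / M%:R @[M --> \oo] --> (0 : R).
  by rewrite -[0](mulr0 t); apply: cvgMr; exact: cvgn_natV.
have sq (M : nat) : (Num.sqrt (6 / M%:R) * v) ^+ 2 = 6 * (t / M%:R).
  by rewrite exprMn sqr_sqrtr ?divr_ge0// -/t mulrA mulrAC.
(* At [x^2 = 6 t/M] the lower exponent is [M (x^2/6 + 3 x^4) = t + 108 t^2/M], with [108 = 3 * 6^2].
   The upper one comes from [1 / (1 + w) = 1 - w / (1 + w) <= exp (- w / (1 + w))] at [w = t/M]. *)
apply: (@squeeze_cvgr _ _ _ _ (fun M : nat => expR (- (t + 108 * t * (t / M%:R))))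
   (fun M : nat => expR (- (t / (1 + t / M%:R))))).
- near=> M.
  have M0 : 0 < M%:R :> R by rewrite ltr0n; near: M; exact: nbhs_infty_gt.
  apply/andP; split.
  + have -> : - (t + 108 * t * (t / M%:R)) =
       M%:R * - (6 * (t / M%:R) / 6 + 3 * (6 * (t / M%:R)) ^+ 2).
      by field; rewrite gt_eqF.
    rewrite expRM_natl lerXn2r ?nnegrE ?expR_ge0 ?(ltW (xdivsinh_gt0 _))//.
    rewrite -sq -exprM; apply: xdivsinh_ge; rewrite sq.
    have : t / M%:R < 6^-1.
      by near: M; apply: (cvgr_lt (0 : R)) => //; rewrite invr_gt0.
    by lra.
  + have tM0 : 0 <= t / M%:R by rewrite divr_ge0// ltW.
    have -> : - (t / (1 + t / M%:R)) = M%:R * - ((t / M%:R) / (1 + t / M%:R)).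
      have Mt : M%:R + t != 0 by rewrite gt_eqF// ltr_pwDl.
      by field; rewrite Mt gt_eqF.
    rewrite expRM_natl lerXn2r ?nnegrE ?expR_ge0 ?(ltW (xdivsinh_gt0 _))//.
    apply: le_trans (xdivsinh_le _) _; rewrite sq.
    apply: le_trans (expR_ge1Dx _).
    rewrite le_eqVlt; apply/orP; left; apply/eqP.
    by move: (t / M%:R) tM0 => w w0; field; rewrite gt_eqF// ltr_pwDl.
- apply: continuous_cvg; first exact: continuous_expR.
  apply: cvgN; rewrite -[X in _ --> X]addr0 -[X in _ --> _ + X](mulr0 (108 * t)).
  by apply: cvgD; [exact: cvg_cst|apply: cvgMr].
- apply: continuous_cvg; first exact: continuous_expR.
  apply: cvgN; rewrite -[X in _ --> X]divr1 -[X in _ / X]addr0.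
  apply: cvgM; first exact: cvg_cst.
  by apply: cvgV; [rewrite addr0 oner_eq0|apply: cvgD => //; exact: cvg_cst].
Unshelve. all: by end_near. Qed.

Lemma Rintegral_scale (R : realType) (c : R) (G : R -> R) : 0 < c ->
  continuous G -> (forall x, 0 <= G x) ->
  \int[mu]_x G x = \int[mu]_x (G (c * x) * c).
Proof.
move=> c0 cG G0.
have dF (x : R) : is_derive x 1 (fun y : R => c * y) c.
  by apply: (is_derive_scale (is_derive_id x 1)); rewrite mulr1.
have eF : derive1 (fun y : R => c * y) = cst c.
  by apply/funext => x; rewrite derive1E; have [_ ->] := dF x.
rewrite /Rintegral (@increasing_ge0_integration_by_substitutionT R (fun y => c * y) G)//.
- by congr fine; apply: eq_integral => x _; rewrite eF.
- by move=> x y xy; rewrite ltr_pM2l.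
- by rewrite eF; exact: cst_continuous.
- by rewrite eF; exact: is_cvg_cst.
- by rewrite eF; exact: is_cvg_cst.
- by apply: gt0_cvgMrNy.
- by apply: gt0_cvgMry.
Qed.

Lemma continuous_xdivsinh_scale (R : realType) (c : R) (m M : nat) :
  continuous (fun x : R => x ^+ (2 * m) * xdivsinh (c * x) ^+ M).
Proof.
move=> x; apply: cvgM; first exact: exprn_continuous.
apply: (@continuous_cvg _ _ _ _ _ (fun x => xdivsinh (c * x)) (fun y : R => y ^+ M)).
  exact: exprn_continuous.
apply: (@continuous_cvg _ _ _ _ _ (fun x : R => c * x) (@xdivsinh R)).
  exact: continuous_xdivsinh.
by apply: cvgMr; exact: cvg_id.
Qed.

(** The product [x^(2m) (1 + x^2)] is at most [(1 + x^2)^(m+1)], which [expr_1Ddiv_ge] with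
    [N = m + 1] compares with [(1 + x^2/M)^M]. The bound is the same for every [M > m]. *)
Lemma xdivsinh_scale_le (R : realType) (m M : nat) (x : R) : (m < M)%N ->
  `|x ^+ (2 * m) * xdivsinh (Num.sqrt (6 / M%:R) * x) ^+ M| <=
  (2 * m.+1%:R) ^+ m.+1 / (1 + x ^+ 2).
Proof.
move=> mM; have M0 : 0 < M%:R :> R by rewrite ltr0n (leq_trans _ mM).
have X0 := sqr_ge0 x.
have e0 := xdivsinh_gt0 (Num.sqrt (6 / M%:R) * x).
have x2m : x ^+ (2 * m) = (x ^+ 2) ^+ m by rewrite exprM.
have xM : 0 < 1 + x ^+ 2 / M%:R by rewrite ltr_pwDl// divr_ge0// ltW.
rewrite ger0_norm; last by rewrite x2m; apply: mulr_ge0; apply: exprn_ge0 => //; exact: ltW.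
have le1 : xdivsinh (Num.sqrt (6 / M%:R) * x) ^+ M <= ((1 + x ^+ 2 / M%:R) ^+ M)^-1.
  rewrite -exprVn lerXn2r ?nnegrE ?invr_ge0 ?(ltW e0) ?(ltW xM)//.
  apply: le_trans (xdivsinh_le _) _.
  rewrite exprMn sqr_sqrtr ?divr_ge0//.
  rewrite (_ : 6 / M%:R * x ^+ 2 / 6 = x ^+ 2 / M%:R)//.
  by field; rewrite gt_eqF.
rewrite ler_pdivlMr ?one_Dsqr_gt0//.
apply: (@le_trans _ _ ((1 + x ^+ 2) ^+ m.+1 * ((1 + x ^+ 2 / M%:R) ^+ M)^-1)).
  rewrite mulrAC ler_pM//.
  - by rewrite x2m; apply: mulr_ge0; [exact: exprn_ge0|exact: addr_ge0].
  - by rewrite exprn_ge0// ltW.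
  - rewrite [_ ^+ m.+1]exprSr ler_wpM2r ?addr_ge0// x2m lerXn2r ?nnegrE ?addr_ge0//.
    by rewrite lerDr.
rewrite ler_pdivrMr ?exprn_gt0//.
exact: expr_1Ddiv_ge.
Qed.

Lemma integrable_xdivsinh_scale (R : realType) (m M : nat) : (m < M)%N ->
  mu.-integrable setT (EFin \o (fun x : R =>
    x ^+ (2 * m) * xdivsinh (Num.sqrt (6 / M%:R) * x) ^+ M)).
Proof.
move=> mM; apply: (@integrable_dominated _ _ ((2 * m.+1%:R) ^+ m.+1)).
  by apply: continuous_measurable_fun; exact: continuous_xdivsinh_scale.
by move=> x; exact: xdivsinh_scale_le.
Qed.

Lemma cvg_Rintegral_xdivsinh (R : realType) (m : nat) :
  \int[mu]_x (x ^+ (2 * m) * xdivsinh (Num.sqrt (6 / M%:R) * x) ^+ M)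
   @[M --> \oo] --> (\int[mu]_x (x ^+ (2 * m) * expR (- x ^+ 2)) : R).
Proof.
pose N := m.+1.
rewrite -(cvg_shiftn N).
pose h (M : nat) (x : R) := x ^+ (2 * m) * xdivsinh (Num.sqrt (6 / M%:R) * x) ^+ M.
pose g (x : R) := x ^+ (2 * m) * expR (- x ^+ 2).
pose K : R := (2 * N%:R) ^+ N.
have cg : continuous g.
  move=> x; apply: cvgM; first exact: exprn_continuous.
  exact: continuous_gauss_fun.
have [] := @dominated_convergence _ _ _ mu setT measurableT
  (fun k => EFin \o h (k + N)%N) (EFin \o g) (EFin \o (fun x : R => K / (1 + x ^+ 2))).
- move=> k; apply/measurable_EFinP; apply: continuous_measurable_fun.
  exact: continuous_xdivsinh_scale.
- by apply/measurable_EFinP; exact: continuous_measurable_fun.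
- apply: aeW => x _; apply: cvg_EFin; first exact: nearW.
  apply: cvgMr; rewrite (cvg_shiftn N (fun M => xdivsinh (Num.sqrt (6 / M%:R) * x) ^+ M)).
  exact: cvg_xdivsinh_expn.
- by have := integrableZl measurableT K (@integrable_oneDsqrV R); exact: eq_integrable.
- by apply: aeW => x k _; rewrite lee_fin xdivsinh_scale_le// leq_addl.
move=> ig _ H.
have := @fine_cvg _ _ _ _ (fun k => \int[mu]_x (EFin \o h (k + N)%N) x)%E
  (fine (\int[mu]_x (EFin \o g) x)%E).
by apply; rewrite fineK//; exact: integrable_fin_num.
Qed.

(** The substitution by [c = sqrt (6/M)] produces [c^(2m+1) = (6/M)^(m + 1/2)]: [2m] factors from
    the monomial and one from [dx]. *)
Lemma Rintegral_xdivsinh_scale (R : realType) (m M : nat) : (m < M)%N ->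
  (M%:R : R) `^ (m%:R + 2^-1) * \int[mu]_x (x ^+ (2 * m) * xdivsinh x ^+ M) =
  6 `^ (m%:R + 2^-1) *
  \int[mu]_x (x ^+ (2 * m) * xdivsinh (Num.sqrt (6 / M%:R) * x) ^+ M).
Proof.
move=> mM; have M0 : 0 < M%:R :> R by rewrite ltr0n (leq_trans _ mM).
have c20 : 0 < 6 / M%:R :> R by rewrite divr_gt0.
set c := Num.sqrt (6 / M%:R); have c0 : 0 < c by rewrite sqrtr_gt0.
rewrite (@Rintegral_scale _ c)//; first last.
- by move=> x; rewrite exprM; apply: mulr_ge0; apply: exprn_ge0; [exact: sqr_ge0|exact/ltW/xdivsinh_gt0].
- have := @continuous_xdivsinh_scale R 1 m M.
  by under eq_fun do rewrite mul1r.
have -> : \int[mu]_x ((c * x) ^+ (2 * m) * xdivsinh (c * x) ^+ M * c) =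
    \int[mu]_x (c ^+ (2 * m).+1 * (x ^+ (2 * m) * xdivsinh (c * x) ^+ M)).
  by apply: eq_Rintegral => x _; rewrite exprMn exprS; ring.
rewrite RintegralZl//; last exact: integrable_xdivsinh_scale.
rewrite mulrA; congr (_ * _).
have -> : c ^+ (2 * m).+1 = (6 / M%:R) `^ (m%:R + 2^-1).
  rewrite powRD ?(gt_eqF c20) ?implybT// powR_mulrn ?(ltW c20)// powR12_sqrt ?(ltW c20)//.
  by rewrite exprSr exprM sqr_sqrtr// ltW.
rewrite -powRM ?(ltW M0) ?(ltW c20)//; congr (_ `^ _).
by field; rewrite gt_eqF.
Qed.

(** * The Gamma function *)

(** Compact exhaustion of the positive half-line, avoiding the singularity at [0]. The exponent [p]
    is there for the substitution [t = u^2], which maps the intervals for [p = 1] onto those for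
    [p = 2]. *)
Definition itvVn (R : realType) (p n : nat) : set R :=
  `[(n.+1%:R ^+ p)^-1, n.+1%:R ^+ p]%classic.

Lemma bigcup_itvVn (R : realType) (p : nat) : (0 < p)%N ->
  \bigcup_n @itvVn R p n = `]0, +oo[%classic.
Proof.
move=> p0; apply/seteqP; split => x /=.
  move=> [n _]; rewrite /itvVn /= !in_itv/= andbT => /andP[nx _].
  by rewrite (lt_le_trans _ nx)// invr_gt0 exprn_gt0.
rewrite in_itv/= andbT => x0.
have [n hn] : exists n : nat, Num.max x x^-1 < n%:R.
  by exists (Num.truncn (Num.max x x^-1)).+1; exact: truncnS_gt.
move: hn; rewrite gt_max => /andP[xn xVn].
have n1 : n%:R <= n.+1%:R ^+ p :> R.
  rewrite -natrX ler_nat (leq_trans (leqnSn _))//.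
  by rewrite -[X in (X <= _)%N]expn1 leq_pexp2l.
exists n => //; rewrite /itvVn /= in_itv/=; apply/andP; split.
  rewrite -[leRHS]invrK lef_pV2 ?posrE ?exprn_gt0 ?invr_gt0//.
  exact: le_trans (ltW xVn) n1.
exact: le_trans (ltW xn) n1.
Qed.

Lemma cvg_integral_itvVn (R : realType) (p : nat) (f : R -> R) : (0 < p)%N ->
  measurable_fun setT f -> (forall x, 0 < x -> 0 <= f x) ->
  (\int[mu]_(x in @itvVn R p n) (f x)%:E)%E @[n --> \oo] -->
  (\int[mu]_(x in `]0%R, +oo[) (f x)%:E)%E.
Proof.
move=> p0 mf f0; rewrite -(bigcup_itvVn R p0).
apply: ge0_nondecreasing_set_cvg_integral.
- move=> n m nm; apply/subsetPset => x; rewrite /itvVn/= !in_itv/= => /andP[h1 h2].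
  have nmp : n.+1%:R ^+ p <= m.+1%:R ^+ p :> R.
    by rewrite -!natrX ler_nat leq_exp2r.
  rewrite (le_trans _ h1) ?(le_trans h2)//.
  by rewrite lef_pV2 ?posrE ?exprn_gt0.
- by move=> n; exact: measurable_itv.
- by move=> n; apply/measurable_EFinP; exact: measurable_funTS.
- move=> n x; rewrite /itvVn/= in_itv/= => /andP[h _]; rewrite lee_fin f0//.
  by rewrite (lt_le_trans _ h)// invr_gt0 exprn_gt0.
Qed.

Definition gamma_fun (R : realType) (x t : R) : R := t `^ (x - 1) * expR (- t).

Lemma measurable_gamma_fun (R : realType) (x : R) :
  measurable_fun setT (gamma_fun x).
Proof.
apply: measurable_funM; first exact: measurable_powR.
by apply: measurableT_comp => //; exact: measurableT_comp.
Qed.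

Lemma gamma_fun_ge0 (R : realType) (x t : R) : 0 <= gamma_fun x t.
Proof. by rewrite mulr_ge0 ?powR_ge0 ?expR_ge0. Qed.

Lemma is_derive_NexpRN (R : realType) (x : R) :
  is_derive x 1 (fun t : R => - expR (- t)) (expR (- x)).
Proof.
by apply: is_derive_eq (is_deriveN (is_derive_expRN x)) _; rewrite opprK.
Qed.

Lemma cvg_gamma_fun0 (R : realType) (x : R) : 0 < x ->
  (n.+1%:R^-1 : R) `^ x * expR (- n.+1%:R^-1) @[n --> \oo] --> (0 : R).
Proof.
move=> x0.
have h : (n.+1%:R^-1 : R) `^ x @[n --> \oo] --> (0 : R).
  have := powR_cvg0 x0 => /cvg_at_rightP; apply; split => [n|]; first by rewrite invr_gt0.
  exact: cvg_harmonic.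
apply: (@squeeze_cvgr _ _ _ _ (cst 0) _ _ _ _ _ h); last exact: cvg_cst.
apply: nearW => n; rewrite mulr_ge0 ?powR_ge0 ?expR_ge0//=.
by rewrite ler_piMr ?powR_ge0// expR_le1 oppr_le0 invr_ge0.
Qed.

Lemma cvg_gamma_funy (R : realType) (x : R) :
  (n.+1%:R : R) `^ x * expR (- n.+1%:R) @[n --> \oo] --> (0 : R).
Proof.
pose N := (Num.truncn x).+1.
have xN : x <= N%:R by exact/ltW/truncnS_gt.
have h : N.+1`!%:R * harmonic n @[n --> \oo] --> (0 : R).
  by rewrite -[0](mulr0 (N.+1`!%:R)); apply: cvgMr; exact: cvg_harmonic.
apply: (@squeeze_cvgr _ _ _ _ (cst 0) _ _ _ _ _ h); last exact: cvg_cst.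
apply: nearW => n; rewrite mulr_ge0 ?powR_ge0 ?expR_ge0//=.
set b : R := n.+1%:R; have b0 : 0 < b by rewrite ltr0n.
have b1 : 1 <= b by rewrite ler1n.
rewrite expRN ler_pdivrMr ?expR_gt0// /harmonic -/b.
apply: (@le_trans _ _ (b ^+ N)).
  by rewrite -powR_mulrn ?(ltW b0)// ler_powR.
have := expR_ge1Dxn N (ltW b0) => h1.
have fN : 0 < N.+1`!%:R :> R by rewrite ltr0n fact_gt0.
rewrite -mulrA -ler_pdivrMl// ler_pdivlMl//.
apply: le_trans h1.
by rewrite mulrCA -exprS mulrC lerDr.
Qed.

Lemma continuous_powR_gt0 (R : realType) (r x : R) : 0 < x ->
  {for x, continuous (fun t : R => t `^ r)}.
Proof. by move=> x0; apply: is_derive1_continuous (is_derive1_powR r x0). Qed.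

Lemma integral_gamma_fun_by_parts (R : realType) (x a b : R) : 0 < x -> 0 < a < b ->
  (\int[mu]_(t in `[a, b]) (gamma_fun (x + 1) t)%:E =
  (- (b `^ x * expR (- b)) + a `^ x * expR (- a))%:E +
  \int[mu]_(t in `[a, b]) (x * gamma_fun x t)%:E)%E.
Proof.
move=> x0 /andP[a0 ab].
have itv0 t : t \in `[a, b] -> 0 < t.
  by rewrite in_itv/= => /andP[+ _]; exact: lt_le_trans.
have itv0' t : t \in `]a, b[ -> 0 < t by move/subset_itv_oo_cc; exact: itv0.
have cN := @continuous_expRN R.
have := @integration_by_parts R (fun t => t `^ x) (fun t => - expR (- t))
  (fun t => x * t `^ (x - 1)) (fun t => expR (- t)) a b ab.
rewrite /gamma_fun addrK => ->.
- rewrite EFinD !mulrN opprK -EFinD.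
  rewrite (_ : (\int[mu]_(t in `[a, b]) (x * t `^ (x - 1) * - expR (- t))%:E =
     - \int[mu]_(t in `[a, b]) (x * (t `^ (x - 1) * expR (- t)))%:E)%E) ?oppeK//.
  rewrite -integral_ge0N//.
    by apply: eq_integral => t _; rewrite mulrN mulrA.
  move=> t /itv0 t0; rewrite lee_fin; apply: mulr_ge0; [exact: ltW|exact: gamma_fun_ge0].
- apply: continuous_in_subspaceT => t /set_mem /itv0 t0.
  by apply: cvgMr; exact: continuous_powR_gt0.
- split.
  + move=> t /itv0' t0; exact: (@ex_derive _ _ _ _ _ _ _ (is_derive1_powR x t0)).
  + by apply: cvg_at_right_filter; exact: continuous_powR_gt0.
  + by apply: cvg_at_left_filter; apply: continuous_powR_gt0; exact: lt_trans ab.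
- by move=> t /itv0' t0; rewrite derive1E; have [_ ->] := is_derive1_powR x t0.
- by apply: continuous_in_subspaceT => t _; exact: cN.
- split.
  + move=> t _; exact: (@ex_derive _ _ _ _ _ _ _ (is_derive_NexpRN t)).
  + by apply: cvg_at_right_filter; apply: cvgN; exact: cN.
  + by apply: cvg_at_left_filter; apply: cvgN; exact: cN.
- by move=> t _; rewrite derive1E; have [_ ->] := is_derive_NexpRN t.
Qed.

(** Integration by parts on the compact intervals; the boundary terms [t^x exp (-t)] vanish at both
    ends because [x > 0]. The index [n = 0] is left out, its interval being the single point [1]. *)
Lemma Gamma_integralS (R : realType) (x : R) : 0 < x ->
  Gamma_integral (x + 1) = x * Gamma_integral x.
Proof.
move=> x0; rewrite /Gamma_integral /Rintegral.
have h1 := cvg_integral_itvVn (ltn0Sn 0) (measurable_gamma_fun (x + 1))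
  (fun t _ => gamma_fun_ge0 (x + 1) t).
have h2 := cvg_integral_itvVn (p := 1) (f := fun t => x * gamma_fun x t) (ltn0Sn 0)
  (measurable_funM (measurable_cst x) (measurable_gamma_fun x))
  (fun t _ => mulr_ge0 (ltW x0) (gamma_fun_ge0 x t)).
pose bd n : R := - (n.+1%:R `^ x * expR (- n.+1%:R)) +
  (n.+1%:R^-1) `^ x * expR (- n.+1%:R^-1).
have e n : (0 < n)%N -> (\int[mu]_(t in @itvVn R 1 n) (gamma_fun (x + 1) t)%:E =
   (bd n)%:E + \int[mu]_(t in @itvVn R 1 n) (x * gamma_fun x t)%:E)%E.
  move=> n0; rewrite /itvVn expr1.
  rewrite integral_gamma_fun_by_parts// invr_gt0 ltr0n/=.
  by rewrite (@lt_trans _ _ 1)// ?invf_lt1// ltr1n.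
have h3 : (\int[mu]_(t in @itvVn R 1 n) (gamma_fun (x + 1) t)%:E)%E @[n --> \oo] -->
   (0%:E + \int[mu]_(t in `]0%R, +oo[) (x * gamma_fun x t)%:E)%E.
  have hb : (bd n)%:E @[n --> \oo] --> 0%:E.
    apply: cvg_EFin; first exact: nearW.
    rewrite -[0]addr0 -[X in X + _ ]oppr0; apply: cvgD; last exact: cvg_gamma_fun0.
    by apply: cvgN; exact: cvg_gamma_funy.
  apply: cvg_trans (cvgeD _ hb h2); last by rewrite fin_num_adde_defr.
  by apply: near_eq_cvg; near=> n; rewrite e//; near: n; exact: nbhs_infty_gt.
have := cvg_unique _ h1 h3.
rewrite add0e /gamma_fun addrK => ->//.
have -> : (\int[mu]_(t in `]0%R, +oo[) (x * (t `^ (x - 1) * expR (- t)))%:E =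
    x%:E * \int[mu]_(t in `]0%R, +oo[) (gamma_fun x t)%:E)%E.
  rewrite -ge0_integralZl//.
  - by apply/measurable_EFinP; apply: measurable_funTS; exact: measurable_gamma_fun.
  - by move=> t _; rewrite lee_fin gamma_fun_ge0.
  - by rewrite lee_fin ltW.
have : (0 <= \int[mu]_(t in `]0%R, +oo[) (gamma_fun x t)%:E)%E.
  by apply: integral_ge0 => t _; rewrite lee_fin gamma_fun_ge0.
(* [fine +oo = 0], so that the identity also holds for a divergent integral. *)
rewrite /gamma_fun; case: integral => [r|_|//] //=.
by rewrite gt0_muley ?lte_fin//= mulr0.
Unshelve. all: by end_near. Qed.

(** Substitution [t = u^2], done on compact intervals because [t^(m - 1/2)] is singular at [0] when
    [m = 0]. The [2] of [dt = 2 u du] is spent on passing from the half-line to the whole line, the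
    integrand being even. *)
Lemma Gamma_integral_half (R : realType) (m : nat) :
  Gamma_integral (m%:R + 2^-1) = \int[mu]_x (x ^+ (2 * m) * expR (- x ^+ 2)) :> R.
Proof.
rewrite /Gamma_integral /Rintegral.
pose y : R := m%:R + 2^-1.
pose g (u : R) := u ^+ (2 * m) * expR (- u ^+ 2).
have cg : continuous g.
  by move=> x; apply: cvgM; [exact: exprn_continuous|exact: continuous_gauss_fun].
have mg : measurable_fun setT g by exact: continuous_measurable_fun.
have g0 u : 0 <= g u by rewrite /g exprM mulr_ge0 ?expR_ge0// exprn_ge0 ?sqr_ge0.
have dF (u : R) : is_derive u 1 (fun t : R => 1 * t ^+ 2) (2 * u).
  by apply: is_derive_eq (is_derive_polyn 2 1 u) _; rewrite /= expr1 mul1r.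
have h1 := cvg_integral_itvVn (ltn0Sn 1) (measurable_gamma_fun y)
  (fun t _ => gamma_fun_ge0 y t).
have h2 := cvg_integral_itvVn (p := 1) (f := fun t => 2 * g t) (ltn0Sn 0)
  (measurable_funM (measurable_cst (2 : R)) mg) (fun t _ => mulr_ge0 (ler0n R 2) (g0 t)).
have e n : (\int[mu]_(t in @itvVn R 2 n) (gamma_fun y t)%:E =
   \int[mu]_(t in @itvVn R 1 n) (2 * g t)%:E)%E.
  rewrite /itvVn expr1 -exprVn.
  have a0 : 0 < n.+1%:R^-1 :> R by rewrite invr_gt0.
  have ab : n.+1%:R^-1 <= n.+1%:R :> R.
    by rewrite (@le_trans _ _ 1)// ?invf_le1// ler1n.
  move: (n.+1%:R : R) a0 ab => b; move: (b^-1) => a a0 ab.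
  have eF : derive1 (fun t : R => 1 * t ^+ 2) = (fun u => 2 * u).
    by apply/funext => u; rewrite derive1E; have [_ ->] := dF u.
  have c2 : continuous (fun u : R => 2 * u) by move=> u; apply: cvgMr; exact: cvg_id.
  have cF (u : R) : {for u, continuous (fun t : R => 1 * t ^+ 2)}.
    exact: is_derive1_continuous (dF u).
  have := @integration_by_substitution_increasing R (fun t => 1 * t ^+ 2) (gamma_fun y) a b ab.
  rewrite !mul1r => ->.
  - apply: eq_integral => u /set_mem /=; rewrite in_itv/= => /andP[au _].
    have u0 : 0 < u by exact: lt_le_trans au.
    congr EFin; rewrite eF !fctE.
    rewrite /gamma_fun /g mul1r.
    rewrite (_ : (u ^+ 2) `^ (y - 1) = u ^+ (2 * m) / u); first by field; rewrite gt_eqF.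
    rewrite -powR_mulrn ?(ltW u0)// -powRrM /y.
    rewrite (_ : 2 * (m%:R + 2^-1 - 1) = (2 * m)%:R - 1); last by rewrite natrM; field.
    by rewrite powRB ?(gt_eqF u0) ?implybT// powR_mulrn ?(ltW u0)// powRr1 ?(ltW u0).
  - move=> u v; rewrite !in_itv/= => /andP[au _] _ uv.
    by rewrite !mul1r ltrXn2r// ltW// (lt_le_trans a0).
  - by rewrite eF => u _; exact: c2.
  - by rewrite eF; apply/cvg_ex; exists (2 * a); apply: cvg_at_right_filter; exact: c2.
  - by rewrite eF; apply/cvg_ex; exists (2 * b); apply: cvg_at_left_filter; exact: c2.
  - split.
    + by move=> u _; exact: (@ex_derive _ _ _ _ _ _ _ (dF u)).
    + by apply: cvg_at_right_filter; exact: cF.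
    + by apply: cvg_at_left_filter; exact: cF.
  - apply: continuous_in_subspaceT => t /set_mem /=; rewrite in_itv/= => /andP[at_ _].
    apply: cvgM.
      by apply: continuous_powR_gt0; apply: lt_le_trans at_; rewrite exprn_gt0.
    exact: continuous_expRN.
have -> : (\int[mu]_(t in `]0%R, +oo[) (t `^ (m%:R + 2^-1 - 1) * expR (- t))%:E =
  \int[mu]_(t in `]0%R, +oo[) (2 * g t)%:E)%E.
  apply: (cvg_unique _ h1) => //.
  rewrite (_ : (fun n => _) = (fun n => \int[mu]_(t in @itvVn R 1 n) (2 * g t)%:E)%E)//.
  by apply/funext => n; exact: e.
rewrite (_ : (\int[mu]_(t in `]0%R, +oo[) (2 * g t)%:E)%E =
  (2%:E * \int[mu]_(t in `]0%R, +oo[) (g t)%:E)%E); last first.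
  rewrite -ge0_integralZl//.
    by apply/measurable_EFinP; exact: measurable_funTS.
  by move=> t _; rewrite lee_fin.
rewrite (@integral_itv_obnd_cbnd _ _ _ (EFin \o g)); last first.
  by apply/measurable_EFinP; exact: measurable_funTS.
rewrite set_itvcy -(ge0_symfun_integralT g0 cg)//.
by move=> u; rewrite /g /= !exprM !sqrrN.
Qed.

Lemma Gamma_integral1 (R : realType) : Gamma_integral 1 = 1 :> R.
Proof.
rewrite /Gamma_integral /Rintegral.
have -> : (\int[mu]_(t in `](0%R : R), +oo[) (t `^ (1 - 1) * expR (- t))%:E =
  \int[mu]_(t in `](0%R : R), +oo[) (expR (- t))%:E)%E.
  by apply: eq_integral => t _; rewrite subrr powRr0 mul1r.
have cN := @continuous_expRN R.
rewrite (@integral_itv_obnd_cbnd _ _ _ (EFin \o (fun t : R => expR (- t)))); last first.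
  by apply/measurable_EFinP; apply: measurable_funTS; exact: continuous_measurable_fun.
rewrite (@ge0_continuous_FTC2y R _ (fun t : R => - expR (- t)) 0 0).
- by rewrite /= oppr0 expR0 opprK add0r.
- by move=> x _; exact: expR_ge0.
- exact: continuous_subspaceT.
- by rewrite -oppr0; apply: cvgN; exact: cvgr_expR.
- by move=> x _; exact: (@ex_derive _ _ _ _ _ _ _ (is_derive_NexpRN x)).
- by apply: cvg_at_right_filter; apply: cvgN; exact: cN.
- by move=> t _; rewrite derive1E; have [_ ->] := is_derive_NexpRN t.
Qed.

Lemma Gamma_integral_half0 (R : realType) : Gamma_integral 2^-1 ^+ 2 = pi :> R.
Proof.
rewrite -[2^-1](add0r) -[0]/(0%:R) Gamma_integral_half.
rewrite /Rintegral (_ : (\int[mu]_x (x ^+ (2 * 0) * expR (- x ^+ 2))%:E)%E =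
   \int[mu]_x (gauss_fun x)%:E)%E.
  by rewrite integralT_gauss /= sqr_sqrtr ?pi_ge0.
by apply: eq_integral => x _; rewrite muln0 expr0 mul1r.
Qed.

Lemma inv_Gamma_gt0 (R : realType) (x : R) : 0 < x ->
  inv_Gamma x = (Gamma_integral x)^-1.
Proof.
move=> x0; rewrite /inv_Gamma /Gamma x0; case: asboolP => // -[j xj].
by move: x0; rewrite xj oppr_gt0 ltrn0.
Qed.

Lemma inv_Gamma_Nnat (R : realType) (j : nat) : inv_Gamma (- j%:R : R) = 0.
Proof. by rewrite /inv_Gamma; case: asboolP => // h; exfalso; apply: h; exists j. Qed.

Lemma Gamma_integral_half_prod (R : realType) (m : nat) :
  Gamma_integral (m%:R + 2^-1) = \prod_(j < m) (j%:R + 2^-1) * Gamma_integral 2^-1 :> R.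
Proof.
elim: m => [|m ih]; first by rewrite big_ord0 mul1r add0r.
rewrite big_ord_recr/= -natr1 addrAC Gamma_integralS.
  by rewrite ih; ring.
by rewrite ltr_wpDl// invr_gt0.
Qed.

(** Euler's reflection formula at a half-integer, where the sine is [(-1)^m]. Here the functional
    equation turns both sides into the same product of half-integers, and [Gamma (1/2)^2 = pi] does
    the rest. *)
Lemma inv_Gamma_half (R : realType) (m : nat) :
  inv_Gamma (2^-1 - m%:R) = (- 1) ^+ m * Gamma_integral (m%:R + 2^-1) / pi :> R.
Proof.
have G2 := @Gamma_integral_half0 R; have p0 := @pi_gt0 R.
have G0 : Gamma_integral 2^-1 != 0 :> R.
  by rewrite -sqrf_eq0 G2 gt_eqF.
case: m => [|m].
  rewrite subr0 add0r expr0 mul1r inv_Gamma_gt0 ?invr_gt0// -G2.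
  by field.
(* The least shift making [1/2 - (m+1)] positive is therefore [m + 1], and the continuation of
   [Gamma] ends at [Gamma_integral (1/2)]. *)
have tr : Num.truncn (- (2^-1 - m.+1%:R : R)) = m.
  apply/truncn_def; rewrite -(natr1 m); apply/andP; split; lra.
rewrite /inv_Gamma /Gamma; case: asboolP => [[j hj]|_].
  exfalso.
  (* A half-integer is no pole: doubling would equate an even and an odd number. *)
  have : (2 * m.+1)%:R = (2 * j).+1%:R :> R by rewrite -(natr1 (2 * j)) !natrM; lra.
  by move/eqP; rewrite eqr_nat => /eqP; lia.
rewrite ifF; last by apply/negbTE; rewrite -leNgt -(natr1 m); have := ler0n R m; lra.
rewrite tr subrK Gamma_integral_half_prod invfM invrK.
have -> : \prod_(j < m.+1) (2^-1 - m.+1%:R + j%:R) =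
    (-1) ^+ m.+1 * \prod_(j < m.+1) (j%:R + 2^-1) :> R.
  transitivity (\prod_(j < m.+1) - (j%:R + 2^-1 : R)).
    (* In reverse order the factors [1/2 - (m+1) + j] become [-(j + 1/2)]. *)
    rewrite (reindex_inj rev_ord_inj)/=; apply: eq_bigr => j _.
    rewrite subSS natrB; last by rewrite -ltnS ltn_ord.
    by rewrite -(natr1 m); field.
  by rewrite prodrN card_ord.
by rewrite -G2; field.
Qed.

(** * The numbers A[n,k] *)

(* [anum n j] is the real number [A[n, n - j]]: on the line [Re z = pi / 2] one has
   [sin z = cosh x], and the imaginary part of the integral vanishes by symmetry. *)
Definition anum (R : realType) (n j : nat) : R :=
  n`!%:R / j`!%:R * pi^-1 * \int[mu]_x complex.Re (czsin j n.+1 (pi / 2 : R) x).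

Lemma csin_pihalf (R : realType) (x : R) : csin (pi / 2) x = (cosh x)%:C.
Proof. by rewrite /csin sin_pihalf cos_pihalf mul1r mul0r. Qed.

Lemma pihalf_le4 (R : realType) : `|pi / 2 : R| <= 4.
Proof.
have /andP[h0 h2] := @pihalf_02 R.
by rewrite ger0_norm ?(ltW h0)//; lra.
Qed.

Lemma czsinN (R : realType) (j m : nat) (x : R) :
  czsin j m (pi / 2) (- x) = (czsin j m (pi / 2) x)^*.
Proof.
rewrite /czsin !csin_pihalf coshN; move: (cosh x) => C.
by rewrite rmorphM fmorphV !rmorphXn /= oppr0.
Qed.

Lemma Rintegral_Im_czsin (R : realType) (j m : nat) :
  \int[mu]_x complex.Im (czsin j m.+1 (pi / 2 : R) x) = 0.
Proof.
have s1 : 0 < sin (pi / 2 : R) by rewrite sin_pihalf.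
have c : continuous (fun x => complex.Im (czsin j m.+1 (pi / 2 : R) x)).
  exact: (is_cderive_continuous (fun x => is_cderive_czsin2 j m.+1 (csin_neq0 x s1))).2.
apply: Rintegral_odd => //.
- have [K hK] := qdecay_czsin j m s1.
  apply: (@integrable_dominated _ _ K); first exact: continuous_measurable_fun.
  move=> x; rewrite (le_trans (normr_Im_le _))// hK//.
  exact: pihalf_le4.
- by move=> x; rewrite czsinN; case: (czsin _ _ _ _).
Qed.

Lemma A_anum (R : realType) (n j : nat) (k : int) : n%:Z - k = j%:Z ->
  A R n k = (anum R n j)%:C.
Proof.
move=> nkj; rewrite /A /anum nkj absz_nat [RHS]rmorphM/=; congr (_ * _).
have e (x : R) : (cosh x ^- n.+1)%:C * ((pi / 2) +i* x) ^ j%:Z = czsin j n.+1 (pi / 2) x.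
  by rewrite /czsin csin_pihalf -exprVn rmorphXn fmorphV /= exprVn mulrC.
rewrite /cintegral.
under eq_Rintegral do rewrite e.
under [X in _ +i* X]eq_Rintegral do rewrite e.
by rewrite Rintegral_Im_czsin.
Qed.

(** The index pairs [(n+2, j+2)] and [(n, j)] share the same [k = n - j], while [(n, j+2)] belongs
    to [k - 2]. The factorial prefactors absorb the coefficients of [Rintegral_czsin_rec]. *)
Lemma anum_rec (R : realType) (n j : nat) :
  anum R n.+2 j.+2 = n.+1%:R ^+ 2 * anum R n j.+2 + anum R n j.
Proof.
have s1 : 0 < sin (pi / 2 : R) by rewrite sin_pihalf.
have := Rintegral_czsin_rec j.+2 n (@pihalf_le4 R) s1.
rewrite /anum /=; set I := \int[mu]_x _; set J := \int[mu]_x _; set L := \int[mu]_x _.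
move=> h.
have f1 i : i.+1`!%:R = i.+1%:R * i`!%:R :> R by rewrite factS natrM.
rewrite !f1.
have fi (i : nat) : i`!%:R != 0 :> R by rewrite pnatr_eq0 -lt0n fact_gt0.
have -> : n.+2%:R * (n.+1%:R * n`!%:R) / (j.+2%:R * (j.+1%:R * j`!%:R)) * pi^-1 * I =
  n`!%:R / (j.+2%:R * (j.+1%:R * j`!%:R)) * pi^-1 * ((n.+1 * n.+2)%:R * I).
  by rewrite natrM; ring.
rewrite h natrX natrM.
have := @pi_gt0 R; have := fi j; have : j.+1%:R != 0 :> R by rewrite pnatr_eq0.
have : j.+2%:R != 0 :> R by rewrite pnatr_eq0.
move: (j.+1%:R : R) (j.+2%:R : R) (pi : R) (j`!%:R : R) => a b p f b0 a0 f0 p0.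
by field; rewrite a0 b0 f0 gt_eqF.
Qed.

(** The case [k = -(q+1)]: the numerator [z^(n+1+q)] cancels the zero of [(sin z)^(n+1)] at the
    origin, so the line may be moved to the imaginary axis. *)
Lemma anum_neg (R : realType) (n q : nat) :
  anum R n (n.+1 + q) = n`!%:R / (n.+1 + q)`!%:R * pi^-1 *
    \int[mu]_x (complex.Re ((0 +i* x) ^+ q) * xdivsinh x ^+ n.+1).
Proof.
rewrite /anum (Rintegral_czsin_0 R q n).2; congr (_ * _).
by apply: eq_Rintegral => x _; rewrite Re_mulCr.
Qed.

Lemma imag_expn_even (R : rcfType) (m : nat) (x : R) :
  (0 +i* x) ^+ (2 * m) = ((-1) ^+ m * x ^+ (2 * m))%:C.
Proof.
rewrite !exprM -exprMn rmorphXn /= (_ : (0 +i* x) ^+ 2 = (- 1 * x ^+ 2)%:C)//.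
rewrite !expr2; apply/eqP; rewrite eq_complex /=.
by apply/andP; split; apply/eqP; ring.
Qed.

Lemma Re_imag_expn_odd (R : rcfType) (m : nat) (x : R) :
  complex.Re ((0 +i* x) ^+ (2 * m).+1) = 0.
Proof. by rewrite exprS imag_expn_even /=; ring. Qed.

(** The parity in the name is that of [q = 2m + 1]; the corresponding [k = -(2m+2)] is even. The
    power [(ix)^q] is purely imaginary. *)
Lemma anum_neg_odd (R : realType) (n m : nat) :
  anum R n (n.+1 + (2 * m).+1) = 0.
Proof.
rewrite anum_neg (_ : \int[mu]_x _ = 0) ?mulr0//.
under eq_Rintegral do rewrite Re_imag_expn_odd mul0r.
by rewrite Rintegral_cst// mul0r.
Qed.

Lemma integrable_xdivsinh (R : realType) (m M : nat) :
  mu.-integrable setT (EFin \o (fun x : R => x ^+ (2 * m) * xdivsinh x ^+ M.+1)).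
Proof.
have := integrableZl measurableT ((-1) ^+ m) (Rintegral_czsin_0 R (2 * m) M).1.
apply: eq_integrable => // x _; rewrite /= Re_mulCr imag_expn_even /= -EFinM; congr EFin.
by rewrite !mulrA -exprD addnn -mul2n exprM sqrrN !expr1n mul1r.
Qed.

Lemma anum_neg_even (R : realType) (n m : nat) :
  anum R n (n.+1 + 2 * m) = n`!%:R / (n.+1 + 2 * m)`!%:R * pi^-1 *
    ((-1) ^+ m * \int[mu]_x (x ^+ (2 * m) * xdivsinh x ^+ n.+1)).
Proof.
rewrite anum_neg; congr (_ * _).
rewrite -RintegralZl//; last exact: integrable_xdivsinh.
by apply: eq_Rintegral => x _; rewrite imag_expn_even /= mulrA.
Qed.

Lemma coshV_le (R : realType) :
  exists K : R, forall (m : nat) (x : R), `|cosh x ^- m.+1| <= K / (1 + x ^+ 2).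
Proof.
have [K K0 hK] := @cosh_dominates R 1.
exists K => m x; have c0 := cosh_gt0 x; have c1 := cosh_ge1 x.
have := hK x; move: (cosh x) c0 c1 => C c0 c1; rewrite expr1 => h.
rewrite ger0_norm ?invr_ge0 ?exprn_ge0 ?(ltW c0)//.
rewrite ler_pdivlMr ?one_Dsqr_gt0// ler_pdivrMl ?exprn_gt0//.
by rewrite mulrC (le_trans h)// ler_wpM2l ?(ltW K0)// ler_eXnr.
Qed.

Lemma continuous_coshV (R : realType) (m : nat) :
  continuous (fun x : R => cosh x ^- m).
Proof.
move=> x; apply: cvgV; first by rewrite expf_neq0// gt_eqF// cosh_gt0.
apply: (@continuous_cvg _ _ _ _ _ (@cosh R) (fun y : R => y ^+ m)).
  exact: exprn_continuous.
exact: continuous_cosh.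
Qed.

Lemma integrable_coshV (R : realType) (m : nat) :
  mu.-integrable setT (EFin \o (fun x : R => cosh x ^- m.+1)).
Proof.
have [K hK] := @coshV_le R; apply: (@integrable_dominated _ _ K).
  by apply: continuous_measurable_fun; exact: continuous_coshV.
by move=> x; exact: hK.
Qed.

(** The primitive is the Gudermannian function [atan (sinh x)]. *)
Lemma Rintegral_coshV (R : realType) : \int[mu]_x (cosh x ^- 1) = pi :> R.
Proof.
have h1 : atan (sinh n%:R) @[n --> \oo] --> (pi / 2 : R).
  apply: (cvg_comp (fun n : nat => sinh n%:R) (@atan R)); last exact: cvgy_atan.
  apply: (@ger_cvgy _ _ _ _ (fun n : nat => n%:R)); last exact: cvgr_idn.
  apply: nearW => n; apply: le_trans (sinh_ge (ler0n R n)).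
  by rewrite lerDl divr_ge0// exprn_ge0.
have dF (x : R) : is_derive x 1 (fun x => atan (sinh x)) (cosh x ^- 1).
  apply: is_derive_eq (is_derive1_comp (is_derive1_atan (sinh x)) (is_derive_sinh x)) _.
  rewrite expr1 (_ : 1 + sinh x ^+ 2 = cosh x ^+ 2); last by rewrite -(cosh2Bsinh2 x) subrK.
  by have := cosh_gt0 x; move: (cosh x) => C C0; field; rewrite gt_eqF.
have h2 : atan (sinh (- n%:R)) @[n --> \oo] --> (- (pi / 2) : R).
  by under eq_fun do rewrite sinhN atanN; exact: cvgN.
rewrite (Rintegral_derive dF (@continuous_coshV R 1) (@integrable_coshV R 0) h1 h2).
by field.
Qed.

Lemma Rintegral_coshV2 (R : realType) : \int[mu]_x (cosh x ^- 2) = 2 :> R.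
Proof.
have h1 : sinh n%:R / cosh n%:R @[n --> \oo] --> (1 : R).
  apply: (@squeeze_cvgr _ _ _ _ (fun n : nat => 1 - expR (- n%:R)) (cst 1)).
  - apply: nearW => n; have c0 := cosh_gt0 (n%:R : R); have c1 := cosh_ge1 (n%:R : R).
    have e : sinh n%:R = cosh n%:R - expR (- n%:R) :> R by rewrite /sinh /cosh; field.
    have e0 := expR_ge0 (- n%:R : R).
    rewrite e; move: (cosh _) (expR _) c0 c1 e0 => C E c0 c1 e0.
    rewrite mulrBl divff ?gt_eqF// lerD2l lerN2 gerBl divr_ge0 ?(ltW c0)// andbT.
    by rewrite ler_pdivrMr// ler_peMr.
  - by rewrite -[X in _ --> X]subr0; apply: cvgB; [exact: cvg_cst|exact: cvgn_expR].
  - exact: cvg_cst.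
have dF (x : R) : is_derive x 1 (fun x => sinh x * (cosh x)^-1) (cosh x ^- 2).
  have c0 : cosh x != 0 by rewrite gt_eqF// cosh_gt0.
  apply: is_derive_eq (is_deriveM (is_derive_sinh x)
    (@is_deriveV R (@cosh R) _ _ _ c0 (is_derive_cosh x))) _.
  rewrite /GRing.scale/=.
  have : sinh x ^+ 2 = cosh x ^+ 2 - 1 by rewrite -(cosh2Bsinh2 x); ring.
  move: (cosh x) (sinh x) c0 => C S c0 SC.
  transitivity ((C ^+ 2 - S ^+ 2) / C ^+ 2); first by field.
  by rewrite SC; field.
have h2 : sinh (- n%:R) / cosh (- n%:R) @[n --> \oo] --> (- 1 : R).
  by under eq_fun do rewrite sinhN coshN mulNr; exact: cvgN.
rewrite (Rintegral_derive dF (@continuous_coshV R 2) (@integrable_coshV R 1) h1 h2).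
by rewrite opprK.
Qed.

Lemma anum00 (R : realType) : anum R 0 0 = 1.
Proof.
rewrite /anum (_ : \int[mu]_x _ = pi).
  have := @pi_gt0 R; move: (pi : R) => p p0.
  by rewrite fact0; field; rewrite gt_eqF.
rewrite -[RHS]Rintegral_coshV; apply: eq_Rintegral => x _.
by rewrite /czsin csin_pihalf expr0 !expr1 mul1r -fmorphV.
Qed.

Lemma anum11 (R : realType) : anum R 1 1 = 1.
Proof.
rewrite /anum (_ : \int[mu]_x _ = pi / 2 * 2).
  rewrite (_ : 1`!%:R = 1 :> R)//; have := @pi_gt0 R.
  by move: (pi : R) => p p0; field; rewrite gt_eqF.
transitivity (pi / 2 * \int[mu]_x (cosh x ^- 2) : R); last by rewrite Rintegral_coshV2.
rewrite -RintegralZl//; last exact: integrable_coshV.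
apply: eq_Rintegral => x _.
rewrite /czsin csin_pihalf expr1 -rmorphXn -fmorphV /= .
by rewrite mulr0 subr0.
Qed.

(** In the recurrence along the diagonal the other term is [anum n (n+2)], the number for [k = -2],
    which vanishes. Two explicit integrals start the induction, one for each parity of [n]. *)
Lemma anum_diag (R : realType) (n : nat) : anum R n n = 1.
Proof.
suff : anum R n n = 1 /\ anum R n.+1 n.+1 = 1 by case.
elim: n => [|n [ih1 ih2]]; first by rewrite anum00 anum11.
split=> //; rewrite anum_rec ih1 -[in anum R n n.+2]addn1 -[in (n.+1 + 1)%N](addn0 1%N).
by rewrite (anum_neg_odd R n 0) mulr0 add0r.
Qed.

(** * Summation of power asymptotics *)

(** After factoring out [n^al], this is the slope of [t^al] at [t = 1] over a step [2/n], expressed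
    by the continuous slope function [G]. *)
Lemma powR_shift2_cvg (R : realType) (al : R) :
  ((n%:R + 2) `^ al - n%:R `^ al) / n%:R `^ (al - 1) @[n --> \oo] --> (2 * al : R).
Proof.
have [G [hG cG G1]] := (is_derive1_caratheodory _ _ _).1 (is_derive1_powR al (@ltr01 R)).
rewrite powR1 mulr1 in G1.
have h : 2 * G (1 + 2 * n%:R^-1) @[n --> \oo] --> (2 * al : R).
  apply: cvgMr; rewrite -G1.
  apply: (@continuous_cvg _ _ _ _ _ (fun n : nat => 1 + 2 * n%:R^-1 : R) G 1) => //.
  rewrite -[X in _ --> X]addr0 -[X in _ --> _ + X](mulr0 2).
  by apply: cvgD; [exact: cvg_cst|apply: cvgMr; exact: cvgn_natV].
apply: cvg_trans h; apply: near_eq_cvg; near=> n.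
have n0 : 0 < n%:R :> R by rewrite ltr0n; near: n; exact: nbhs_infty_gt.
move: (n%:R : R) n0 => y y0.
have y2 : 0 <= 1 + 2 * y^-1 by rewrite addr_ge0 ?mulr_ge0 ?invr_ge0// ltW.
have e : y + 2 = y * (1 + 2 * y^-1) by field; rewrite gt_eqF.
have p0 : y `^ al != 0 by rewrite gt_eqF// powR_gt0.
have := hG (1 + 2 * y^-1); rewrite powR1 addrAC subrr add0r => hg.
rewrite e powRM ?(ltW y0)// powRB ?(gt_eqF y0) ?implybT// powRr1 ?(ltW y0)//.
transitivity (((1 + 2 * y^-1) `^ al - 1) * y); last by field; rewrite p0 gt_eqF.
by rewrite hg; field; rewrite gt_eqF.
Unshelve. all: by end_near. Qed.

(** Stolz-Cesaro for increments over two steps, in little-o form. Telescoping runs separately over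
    the two parities, and the initial terms are negligible because [g] tends to infinity. *)
Lemma stolz_cesaro2 (R : realType) (u g : nat -> R) :
  (forall e : R, 0 < e ->
     \forall n \near \oo, `|u n.+2 - u n| <= e * (g n.+2 - g n)) ->
  g n @[n --> \oo] --> +oo -> u n / g n @[n --> \oo] --> (0 : R).
Proof.
move=> h gy; apply/cvgr0Pnorm_le => e e0.
have e2 : 0 < e / 2 by rewrite divr_gt0.
have [N _ hN] := h _ e2.
(* Starts both parities at once, at [N] and [N+1]; the absolute values of [g] allow for negative
   initial values. *)
pose C : R := `|u N| + `|u N.+1| + e / 2 * (`|g N| + `|g N.+1|).
have bound n : `|u (N + n)%N| <= C + e / 2 * g (N + n)%N.
  have h0 (i : R) : 0 <= `|i| by [].
  have hg (i : R) : - `|i| <= i by rewrite lerNl -normrN ler_norm.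
  suff : `|u (N + n)%N| <= C + e / 2 * g (N + n)%N /\
    `|u (N + n.+1)%N| <= C + e / 2 * g (N + n.+1)%N by case.
  elim: n => [|n [ih1 ih2]].
    have e20 := ltW e2.
    have m0 (i : R) := mulr_ge0 e20 (h0 i).
    have mg (i : R) := ler_wpM2l e20 (hg i).
    rewrite addn0 addn1 /C.
    have := m0 (g N); have := m0 (g N.+1); have := mg (g N); have := mg (g N.+1).
    by have := h0 (u N); have := h0 (u N.+1); split; nra.
  split=> //; rewrite !addnS in ih1 ih2 *.
  have := hN (N + n)%N (leq_addr _ _) => /= hn.
  have := ler_normD (u (N + n).+2 - u (N + n)%N) (u (N + n)%N); rewrite subrK.
  by lra.
near=> n.
have nN : (N <= n)%N by near: n; exact: nbhs_infty_ge.
have gn : 2 * C / e <= g n by near: n; apply: (cvgryPge _).1.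
have g1 : 1 <= g n by near: n; apply: (cvgryPge _).1.
have g0 : 0 < g n by exact: lt_le_trans g1.
rewrite normrM normfV (gtr0_norm g0) ler_pdivrMr//.
have := bound (n - N)%N; rewrite subnKC// => hb.
apply: (le_trans hb).
have : C <= e / 2 * g n by rewrite -ler_pdivrMl// invf_div mulrC mulrCA mulrA.
by lra.
Unshelve. all: by end_near. Qed.

Lemma cvg_powRy (R : realType) (al : R) : 0 < al ->
  (n%:R : R) `^ al @[n --> \oo] --> +oo.
Proof.
move=> al0; apply/cvgryPge => M.
near=> n.
have M1 : 0 < `|M| + 1 by rewrite ltr_wpDl.
apply: (@le_trans _ _ (`|M| + 1)); first by rewrite (le_trans (ler_norm _))// lerDl.
have -> : `|M| + 1 = ((`|M| + 1) `^ al^-1) `^ al.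
  by rewrite -powRrM mulVf ?gt_eqF// powRr1// ltW.
apply: ge0_ler_powR; rewrite ?nnegrE ?powR_ge0// ?ltW//.
by near: n; apply: (cvgryPgt _).1; exact: cvgr_idn.
Unshelve. all: by end_near. Qed.

(** The increments of [x] are of order [c n^(al-1)], those of [n^al] of order [2 al n^(al-1)].
    Subtracting [L n^al] with [L = c / (2 al)] leaves increments of smaller order, to which
    [stolz_cesaro2] applies. *)
Lemma summation2_cvg (R : realType) (x y : nat -> R) (al c : R) : 0 < al ->
  (\forall n \near \oo, x n.+2 - x n = n.+1%:R ^+ 2 * y n) ->
  y n / n%:R `^ (al - 3) @[n --> \oo] --> c ->
  x n / n%:R `^ al @[n --> \oo] --> c / (2 * al).
Proof.
move=> al0 xy yc.
pose g (n : nat) : R := n%:R `^ al.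
pose L := c / (2 * al).
have gy : g n @[n --> \oo] --> +oo by exact: cvg_powRy.
have h0 : (x n - L * g n) / g n @[n --> \oo] --> (0 : R).
  apply: stolz_cesaro2 => // e e0.
  have hD : (g n.+2 - g n) / n%:R `^ (al - 1) @[n --> \oo] --> 2 * al.
    have e2 n : n%:R + 2 = n.+2%:R :> R by rewrite -natrD addn2.
    by have := @powR_shift2_cvg R al; under eq_fun do rewrite e2.
  have hx : (x n.+2 - x n) / n%:R `^ (al - 1) @[n --> \oo] --> c.
    have n1 : (1 + n%:R^-1) ^+ 2 * (y n / n%:R `^ (al - 3)) @[n --> \oo] --> c.
      rewrite -[c]mul1r; apply: cvgM => //.
      have h1 : 1 + n%:R^-1 @[n --> \oo] --> (1 : R).
        by rewrite -[X in _ --> X]addr0; apply: cvgD; [exact: cvg_cst|exact: cvgn_natV].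
      rewrite -[X in _ --> X](expr1n _ 2).
      apply: (@continuous_cvg _ _ _ _ _ (fun n : nat => 1 + n%:R^-1 : R) (fun z : R => z ^+ 2) 1) => //.
      exact: exprn_continuous.
    apply: cvg_trans n1; apply: near_eq_cvg; near=> n.
    have n0 : 0 < n%:R :> R by rewrite ltr0n; near: n; exact: nbhs_infty_gt.
    rewrite (_ : x n.+2 - x n = n.+1%:R ^+ 2 * y n); last by near: n.
    have -> : n%:R `^ (al - 1) = n%:R `^ (al - 3) * n%:R ^+ 2 :> R.
      rewrite -powR_mulrn ?(ltW n0)// -powRD; first by congr (_ `^ _); ring.
      by rewrite (gt_eqF n0) implybT.
    have p0 : n%:R `^ (al - 3) != 0 :> R by rewrite gt_eqF// powR_gt0.
    by rewrite -(natr1 n); field; rewrite p0 gt_eqF.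
  have hu : ((x n.+2 - L * g n.+2) - (x n - L * g n)) / n%:R `^ (al - 1)
     @[n --> \oo] --> (0 : R).
    have -> : 0 = c - L * (2 * al) by rewrite /L; field; rewrite gt_eqF.
    have hL : L * ((g n.+2 - g n) / n%:R `^ (al - 1)) @[n --> \oo] --> L * (2 * al).
      by apply: cvgMr.
    apply: cvg_trans (cvgB hx hL); apply: near_eq_cvg; near=> n.
    by rewrite !fctE; ring.
  near=> n.
  have n0 : 0 < n%:R :> R by rewrite ltr0n; near: n; exact: nbhs_infty_gt.
  have p0 : 0 < n%:R `^ (al - 1) :> R by rewrite powR_gt0.
  have u1 : `|((x n.+2 - L * g n.+2) - (x n - L * g n)) / n%:R `^ (al - 1)| <= e * al.
    by near: n; move/cvgr0Pnorm_le: hu; apply; rewrite mulr_gt0.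
  (* Half of the limit [2 al] in [hD] is kept; it turns the bound [e al n^(al-1)] into [e] times the
     increment of [g]. *)
  have d1 : al <= (g n.+2 - g n) / n%:R `^ (al - 1).
    by near: n; apply: (cvgr_ge (2 * al)) => //; lra.
  move: u1; rewrite normrM normfV (gtr0_norm p0) ler_pdivrMr// => u1.
  apply: (le_trans u1); rewrite -mulrA ler_wpM2l ?(ltW e0)//.
  by rewrite -ler_pdivlMr.
rewrite -[X in _ --> X]add0r; apply: cvg_trans (cvgD h0 (cvg_cst L)).
apply: near_eq_cvg; near=> n.
have n0 : 0 < n%:R :> R by rewrite ltr0n; near: n; exact: nbhs_infty_gt.
have p0 : n%:R `^ al != 0 :> R by rewrite gt_eqF// powR_gt0.
by rewrite !fctE /g; field.
Unshelve. all: by end_near. Qed.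

Lemma cvg_fact_ratio (R : realType) (p : nat) :
  n`!%:R / (n + p)`!%:R * n%:R ^+ p @[n --> \oo] --> (1 : R).
Proof.
elim: p => [|p ih].
  under eq_fun => n do rewrite addn0 expr0 mulr1 divff ?pnatr_eq0 -?lt0n ?fact_gt0//.
  exact: cvg_cst.
have h : (n + p).+1%:R^-1 * n%:R @[n --> \oo] --> (1 : R).
  have h1 : (1 + p.+1%:R * n%:R^-1)^-1 @[n --> \oo] --> (1 : R).
    rewrite -[X in _ --> X]invr1; apply: cvgV; first exact: oner_neq0.
    rewrite -[X in _ --> X]addr0 -[X in _ --> _ + X](mulr0 p.+1%:R).
    by apply: cvgD; [exact: cvg_cst|apply: cvgMr; exact: cvgn_natV].
  apply: cvg_trans h1; apply: near_eq_cvg; near=> n.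
  have n0 : 0 < n%:R :> R by rewrite ltr0n; near: n; exact: nbhs_infty_gt.
  rewrite -addnS natrD; have : 0 < p.+1%:R :> R by [].
  move: (n%:R : R) (p.+1%:R : R) n0 => a b a0 b0.
  by field; rewrite !gt_eqF ?addr_gt0.
rewrite -[X in _ --> X]mulr1; apply: cvg_trans (cvgM ih h); apply: near_eq_cvg; near=> n.
rewrite addnS factS natrM exprS invfM /=.
move: ((n + p).+1%:R : R) ((n + p)`!%:R : R) (n`!%:R : R) (n%:R : R) => a b f z.
by ring.
Unshelve. all: by end_near. Qed.

Lemma cvg_real_complex (R : realType) (u : nat -> R) (l : R) :
  u n @[n --> \oo] --> l -> ((u n)%:C : R[i]^o) @[n --> \oo] --> (l%:C : R[i]^o).
Proof.
move=> h; apply/cvgrPdist_lt => e e0.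
have [e1 e2] : 0 < complex.Re e /\ complex.Im e = 0.
  by move: e0; rewrite ltcE /= => /andP[/eqP -> ->].
move/cvgrPdist_lt : h => /(_ _ e1); apply: filterS => n hn.
rewrite -rmorphB /= normc_def /= expr0n addr0 sqrtr_sqr.
by rewrite ltcE /= e2 eqxx.
Qed.

Definition climit (R : realType) (k : int) : R :=
  (6 `^ (k%:~R / 2))^-1 * inv_Gamma (k%:~R / 2 + 1).

(** For [n >= k], hence for all large [n], the absolute value is [n - k] and the numerator is
    [A[n,k]]. *)
Definition anum_cvg (R : realType) (k : int) :=
  anum R n `|n%:Z - k|%N / n%:R `^ (3 * k%:~R / 2) @[n --> \oo] --> climit R k.

Lemma anum_cvg_neg_even (R : realType) (m : nat) : anum_cvg R (- (2 * m).+2%:Z).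
Proof.
rewrite /anum_cvg /climit.
have -> : (- (2 * m).+2%:Z)%:~R / 2 + 1 = - m%:R :> R.
  by rewrite rmorphN /= -pmulrn -(natr1 (2 * m).+1) -(natr1 (2 * m)) natrM; field.
rewrite inv_Gamma_Nnat mulr0; apply: cvg_near_cst; apply: nearW => n.
have -> : `|n%:Z - - (2 * m).+2%:Z|%N = (n.+1 + (2 * m).+1)%N by lia.
by rewrite anum_neg_odd mul0r.
Qed.

(** With [al = m + 1/2 = -k/2], write [n^(3 al) = n^(2m+1) n^al]: the first factor balances the
    ratio of factorials, the second the rescaled integral. The leftover
    [(-1)^m Gamma_integral al / pi] is [1 / Gamma] at [1/2 - m = k/2 + 1], by [inv_Gamma_half]. *)
Lemma anum_cvg_neg_odd (R : realType) (m : nat) : anum_cvg R (- (2 * m).+1%:Z).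
Proof.
rewrite /anum_cvg /climit.
set k : R := (- (2 * m).+1%:Z)%:~R.
have ke : k = - (2 * m%:R + 1) by rewrite /k rmorphN /= -pmulrn -(natr1 (2 * m)) natrM.
pose al : R := m%:R + 2^-1.
have -> : k / 2 + 1 = 2^-1 - m%:R by rewrite ke; field.
have -> : k / 2 = - al by rewrite ke /al; field.
have -> : 3 * k / 2 = - (3 * al) by rewrite ke /al; field.
rewrite powRN invrK inv_Gamma_half.
pose I (M : nat) : R := \int[mu]_x (x ^+ (2 * m) * xdivsinh x ^+ M).
have h1 : M%:R `^ al * I M @[M --> \oo] --> 6 `^ al * Gamma_integral al.
  rewrite /al Gamma_integral_half.
  have h : 6 `^ (m%:R + 2^-1) * \int[mu]_x (x ^+ (2 * m) *
      xdivsinh (Num.sqrt (6 / M%:R) * x) ^+ M) @[M --> \oo] -->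
      (6 `^ (m%:R + 2^-1) * \int[mu]_x (x ^+ (2 * m) * expR (- x ^+ 2)) : R).
    by apply: cvgMr; exact: cvg_Rintegral_xdivsinh.
  apply: cvg_trans h; apply: near_eq_cvg; near=> M.
  by rewrite -Rintegral_xdivsinh_scale//; near: M; exact: nbhs_infty_gt.
have h2 : n.+1%:R `^ al * I n.+1 @[n --> \oo] --> 6 `^ al * Gamma_integral al.
  by rewrite (cvg_shiftS (fun M => M%:R `^ al * I M)).
(* The integrand carries the power [n + 1] of [x / sinh x], so rescaling brings [(n+1)^al]; this
   factor converts it to [n^al]. *)
have h3 : (1 + n%:R^-1) `^ (- al) @[n --> \oo] --> (1 : R).
  have e1 : (1 : R) `^ (- al) = 1 by rewrite powR1.
  rewrite -[X in _ --> X]e1.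
  apply: (@continuous_cvg _ _ _ _ _ (fun n : nat => 1 + n%:R^-1 : R) (fun z : R => z `^ (- al)) 1).
    exact: continuous_powR_gt0.
  by rewrite -[X in _ --> X]addr0; apply: cvgD; [exact: cvg_cst|exact: cvgn_natV].
have h := cvgM (cvgM (@cvg_fact_ratio R (2 * m).+1) h3) h2.
have h' : ((-1) ^+ m / pi) * (n`!%:R / (n + (2 * m).+1)`!%:R * n%:R ^+ (2 * m).+1 *
   (1 + n%:R^-1) `^ (- al) * (n.+1%:R `^ al * I n.+1)) @[n --> \oo] -->
   (((-1) ^+ m / pi) * (1 * 1 * (6 `^ al * Gamma_integral al)) : R).
  by apply: cvgMr; exact: h.
rewrite (_ : 6 `^ al * _ = ((-1) ^+ m / pi) * (1 * 1 * (6 `^ al * Gamma_integral al))); last first.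
  by rewrite /al; ring.
apply: cvg_trans h'; apply: near_eq_cvg; near=> n.
have n0 : 0 < n%:R :> R by rewrite ltr0n; near: n; exact: nbhs_infty_gt.
have -> : `|n%:Z - - (2 * m).+1%:Z|%N = (n.+1 + 2 * m)%N by lia.
rewrite anum_neg_even -/(I n.+1) addSnnS.
have -> : n.+1%:R = n%:R * (1 + n%:R^-1) :> R by rewrite -(natr1 n); field; rewrite gt_eqF.
have q0 : 0 < 1 + n%:R^-1 :> R by rewrite ltr_pwDl// invr_ge0 ltW.
rewrite (powRM al (ltW n0) (ltW q0)) !powRN invrK.
have -> : n%:R `^ (3 * al) = n%:R ^+ (2 * m).+1 * n%:R `^ al :> R.
  rewrite -powR_mulrn ?(ltW n0)// -powRD; last by rewrite (gt_eqF n0) implybT.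
  by congr (_ `^ _); rewrite -(natr1 (2 * m)) natrM /al; field.
have : (1 + n%:R^-1) `^ al != 0 :> R by rewrite gt_eqF// powR_gt0.
have : pi != 0 :> R by rewrite gt_eqF// pi_gt0.
have : (n + (2 * m).+1)`!%:R != 0 :> R by rewrite pnatr_eq0 -lt0n fact_gt0.
move: ((1 + n%:R^-1) `^ al) (pi : R) ((n + (2 * m).+1)`!%:R : R) => w p f f0 p0 w0.
by field; rewrite f0 p0 w0.
Unshelve. all: by end_near. Qed.

(** Functional equation of [Gamma] at [k/2], together with one factor [6]. The denominator [3k] is
    written as [2 al] with [al = 3k/2], the form delivered by [summation2_cvg]. *)
Lemma climit_rec (R : realType) (k : nat) : (0 < k)%N ->
  climit R k%:Z = climit R (k%:Z - 2) / (2 * (3 * (k%:Z)%:~R / 2)).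
Proof.
move=> k0; rewrite /climit rmorphB /= -!pmulrn.
have x0 : 0 < k%:R / 2 :> R by rewrite divr_gt0// ltr0n.
have -> : (k%:R - 2%:~R) / 2 + 1 = k%:R / 2 :> R by field.
have -> : (k%:R - 2%:~R) / 2 = k%:R / 2 - 1 :> R by field.
rewrite !inv_Gamma_gt0 ?addr_gt0// Gamma_integralS//.
have -> : 6 `^ (k%:R / 2 - 1) = 6 `^ (k%:R / 2) / 6 :> R.
  by rewrite powRB ?powRr1// pnatr_eq0 implybT.
have p0 : 6 `^ (k%:R / 2) != 0 :> R by rewrite gt_eqF// powR_gt0.
rewrite !invfM invrK.
have kn0 : k%:R != 0 :> R by rewrite pnatr_eq0 -lt0n.
set b := (Gamma_integral (k%:R / 2))^-1; move: b => b.
by field; rewrite p0 kn0.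
Qed.

Lemma anum_cvg_nat (R : realType) (k : nat) : (0 < k)%N ->
  anum_cvg R (k%:Z - 2) -> anum_cvg R k%:Z.
Proof.
move=> k0 h; rewrite /anum_cvg climit_rec//.
have al0 : 0 < 3 * (k%:Z)%:~R / 2 :> R by rewrite divr_gt0// mulr_gt0// -pmulrn ltr0n.
refine (@summation2_cvg _ _ (fun n => anum R n `|n%:Z - (k%:Z - 2)%R|%N) _ _ al0 _ _).
- near=> n.
  have kn : (k <= n)%N by near: n; exact: nbhs_infty_ge.
  have -> : `|n.+2%:Z - k%:Z|%N = (n - k).+2 by lia.
  have -> : `|n%:Z - k%:Z|%N = (n - k)%N by lia.
  have -> : `|n%:Z - (k%:Z - 2)%R|%N = (n - k).+2 by lia.
  by rewrite anum_rec addrK.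
- rewrite (_ : 3 * (k%:Z)%:~R / 2 - 3 = 3 * (k%:Z - 2)%:~R / 2)//.
  by rewrite rmorphB /=; field.
Unshelve. all: by end_near. Qed.

Lemma anum_cvg_0 (R : realType) : anum_cvg R 0.
Proof.
rewrite /anum_cvg /climit mul0r powRr0 invr1 mul1r add0r inv_Gamma_gt0//.
rewrite Gamma_integral1 invr1; apply: cvg_near_cst; apply: nearW => n.
by rewrite subr0 absz_nat anum_diag mulr0 mul0r powRr0 divr1.
Qed.

Lemma anum_cvgP (R : realType) (k : int) : anum_cvg R k.
Proof.
case: k => [k|q]; last first.
  (* [Negz q] is [-(q+1)], so an odd [q] gives an even [k]. *)
  rewrite NegzE -(odd_double_half q); case: (odd q); rewrite ?add1n ?add0n -mul2n.
    exact: anum_cvg_neg_even.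
  exact: anum_cvg_neg_odd.
suff [] : anum_cvg R k /\ anum_cvg R k.+1 by [].
elim: k => [|k [ih1 ih2]].
  split; first exact: anum_cvg_0.
  apply: anum_cvg_nat => //.
  (* The odd chain enters the positive range here: [k = 1] is reached from [k = -1]. *)
  by rewrite (_ : 1%:Z - 2 = - (2 * 0).+1%:Z)//; exact: anum_cvg_neg_odd.
split => //; apply: anum_cvg_nat => //.
by rewrite (_ : k.+2%:Z - 2 = k%:Z)//; lia.
Qed.

Theorem theorem1p1 (R : realType) (k : int) :
  (fun d : nat => A R d k / ((d%:R : R) `^ (3 * k%:~R / 2))%:C : R[i]^o) @ \oo -->
  (((6 `^ (k%:~R / 2))^-1 * inv_Gamma (k%:~R / 2 + 1))%:C : R[i]^o).
Proof.
apply: cvg_trans (cvg_real_complex (@anum_cvgP R k)); apply: near_eq_cvg; near=> d.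
have kd : (`|k| <= d)%N by near: d; exact: nbhs_infty_ge.
have kd' : d%:Z - k = `|d%:Z - k|%N%:Z by lia.
by rewrite (A_anum R kd') rmorphM fmorphV.
Unshelve. all: by end_near. Qed.
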